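(* Consider offline RL in a horizon-$H$ MDP with datasets $\mathcal D_1,\dots,\mathcal D_H$ of $N$ samples each, a finite policy class $\Pi$, and a finite class $\mathcal F=\mathcal F_1\times\cdots\times\mathcal F_H$ of conditional distributions satisfying distributional Bellman completeness: for all policies $\pi$ and $h\in[H]$, $f_{h+1}\in\mathcal F_{h+1}$ implies $\mathcal T_h^{\pi,D}f_{h+1}\in\mathcal F_h$. For any $\delta\in(0,1)$, with probability at least $1-\delta$, running P-DISCO with $\beta=\log(H|\Pi||\mathcal F|/\delta)$ learns a policy $\hat\pi$ such that for any comparator policy $\tilde\pi\in\Pi$, $$V^{\hat\pi}-V^{\tilde\pi}\le9H\sqrt{\frac{C^{\tilde\pi}V^{\tilde\pi}\beta}{N}}+\frac{30H^2C^{\tilde\pi}\beta}{N}.$$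
   Context: MDP. Observation space $\mathcal X$, finite action space $\mathcal A$, horizon $H$, transition kernels $P_h:\mathcal X\times\mathcal A\to\Delta(\mathcal X)$, cost distributions $C_h:\mathcal X\times\mathcal A\to\Delta([0,1])$, fixed initial state $x_1$. $\Delta([0,1])$ denotes distributions on $[0,1]$ absolutely continuous w.r.t. a fixed dominating measure $\lambda$, identified with densities; $\bar f$ is the mean of $f$. A policy $\pi=(\pi_1,\dots,\pi_H)$, $\pi_h:\mathcal X\to\Delta(\mathcal A)$, generates $a_h\sim\pi_h(x_h)$, $c_h\sim C_h(x_h,a_h)$, $x_{h+1}\sim P_h(x_h,a_h)$. Cumulative costs $\sum_hc_h$ lie in $[0,1]$. $V^\pi=\mathbb E_\pi[\sum_hc_h]$; $d_h^\pi$ is the law of $(x_h,a_h)$ under $\pi$. Data. Each $\mathcal D_h$ contains $N$ i.i.d. samples $(x_{h,i},a_{h,i},c_{h,i},x'_{h,i})$ with $(x_{h,i},a_{h,i})\sim\nu_h$, $c_{h,i}\sim C_h(x_{h,i},a_{h,i})$, $x'_{h,i}\sim P_h(x_{h,i},a_{h,i})$, for arbitrary $\nu_h\in\Delta(\mathcal X\times\mathcal A)$. The single-policy concentrability is $C^{\tilde\pi}=\max_h\|d d_h^{\tilde\pi}/d\nu_h\|_\infty$ (sup-norm of the Radon–Nikodym derivative). Distributional Bellman operator. $\mathcal T_h^{\pi,D}d(x,a)$ is the law of $c+y$ with $c\sim C_h(x,a)$, $x'\sim P_h(x,a)$, $a'\sim\pi_{h+1}(x')$, $y\sim d(x',a')$.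 Function class. Elements $f=(f_1,\dots,f_H)\in\mathcal F$, $f_h:\mathcal X\times\mathcal A\to\Delta([0,1])$; by convention $f_{H+1}=\delta_0$ (Dirac at $0$), $\mathcal F_{H+1}=\{\delta_0\}$. Algorithm P-DISCO (input $\mathcal D_1,\dots,\mathcal D_H,\mathcal F,\beta,\Pi$). For all $(h,f,\pi)\in[H]\times\mathcal F\times\Pi$ and each $i\in[N]$, sample $y_{h,i}^{f,\pi}\sim f_{h+1}(x'_{h,i},\pi_{h+1}(x'_{h,i}))$, set $z_{h,i}^{f,\pi}=c_{h,i}+y_{h,i}^{f,\pi}$, and define $$\mathcal F_\pi=\Big\{f\in\mathcal F:\ \sum_{i=1}^N\log f_h(z_{h,i}^{f,\pi}\mid x_{h,i},a_{h,i})\ge\max_{g\in\mathcal F_h}\sum_{i=1}^N\log g(z_{h,i}^{f,\pi}\mid x_{h,i},a_{h,i})-7\beta,\ \forall h\in[H]\Big\}.$$ For each $\pi\in\Pi$ let $f^\pi=\arg\max_{f\in\mathcal F_\pi}\mathbb E_{a\sim\pi_1(x_1)}[\bar f_1(x_1,a)]$. Output $\hat\pi=\arg\min_{\pi\in\Pi}\mathbb E_{a\sim\pi_1(x_1)}[\bar f_1^\pi(x_1,a)]$. *)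

(* Defs.v *)
From HB Require Import structures.
From mathcomp Require Import all_boot all_order all_algebra.
From mathcomp Require Import all_classical all_reals all_analysis measurable_realfun ess_sup_inf.
Set Implicit Arguments.
Unset Strict Implicit.
Unset Printing Implicit Defensive.
Import Order.TTheory GRing.Theory Num.Theory.
Import numFieldNormedType.Exports.
Local Open Scope classical_set_scope.
Local Open Scope ring_scope.

Section kernels.
Local Open Scope ereal_scope.

Section kpre.
Context d1 d2 d3 (S : measurableType d1) (T : measurableType d2)
  (U : measurableType d3) (R : realType).

Definition kpre (k : R.-pker T ~> U) (f : S -> T) (mf : measurable_fun setT f)
  (x : S) : {measure set U -> \bar R} := k (f x).

Context (k : R.-pker T ~> U) (f : S -> T) (mf : measurable_fun setT f).

Let measurable_kpre B : measurable B -> measurable_fun [set: S] (kpre k mf ^~ B).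
Proof. by move=> mB; exact: (measurableT_comp (measurable_kernel k B mB) mf). Qed.

HB.instance Definition _ := isKernel.Build _ _ _ _ _ (kpre k mf) measurable_kpre.

Let kpre_prob x : kpre k mf x setT = 1.
Proof. exact: prob_kernel. Qed.

HB.instance Definition _ := Kernel_isProbability.Build _ _ _ _ _
  (kpre k mf) kpre_prob.
End kpre.

Section mkcomp_prob.
Context d1 d2 d3 (S : measurableType d1) (T : measurableType d2)
  (U : measurableType d3) (R : realType).
Context (l : R.-pker S ~> T) (k : R.-pker (S * T) ~> U).

Let mkcomp_prob x : (l \; k) x setT = 1.
Proof.
rewrite /mkcomp/= /kcomp; under eq_integral do rewrite prob_kernel.
by rewrite integral_cst// prob_kernel mule1.
Qed.

HB.instance Definition _ := Kernel_isProbability.Build _ _ _ _ _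
  (l \; k) mkcomp_prob.
End mkcomp_prob.

End kernels.

Section mdp.
Context dX dA (X : measurableType dX) (A : measurableType dA) (R : realType).
Local Open Scope ereal_scope.
Local Open Scope charge_scope.

(* Time steps are numbered from 0, so that the step h of the literature is
   h.-1 here; with horizon H, only the components with index < H matter. *)
Record mdp := MDP {
  trans : nat -> R.-pker (X * A) ~> X ;
  cost : nat -> R.-pker (X * A) ~> R ;
  init : X }.

Definition policy := nat -> R.-pker X ~> A.

Context (M : mdp).

Let meas_state : measurable_fun setT (fst : X * R -> X).
Proof. exact: measurable_fst. Qed.

Let meas_cost_arg :
  measurable_fun setT (fun u : X * R * A => (u.1.1, u.2) : X * A).
Proof.
by apply/measurable_fun_pair => //; do 2?[exact: measurableT_comp].
Qed.

Let meas_trans_arg :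
  measurable_fun setT (fun u : X * R * A * R => (u.1.1.1, u.1.2) : X * A).
Proof.
apply/measurable_fun_pair; first by do 2!apply: measurableT_comp => //.
exact: measurableT_comp.
Qed.

Let meas_next : measurable_fun setT
  (fun u : X * R * A * R * X => (u.2, u.1.1.1.2 + u.1.2)%R : X * R).
Proof.
apply/measurable_fun_pair => //; apply: measurable_funD.
  by do 3!apply: measurableT_comp => //.
exact: measurableT_comp.
Qed.

(* From the state x and the accumulated cost s: a ~ pi_h(x), c ~ C_h(x, a),
   x' ~ P_h(x, a), leading to (x', s + c). *)
Definition mdp_step (pi : policy) (h : nat) : R.-pker (X * R) ~> (X * R)%type :=
  kpre (pi h) meas_state \;
  (kpre (cost M h) meas_cost_arg \;
  (kpre (trans M h) meas_trans_arg \;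
   kdirac meas_next)).

Let meas_id : measurable_fun setT (id : X * R -> X * R).
Proof. exact: measurable_id. Qed.

Let meas_cur : measurable_fun setT (snd : X * R * (X * R) -> X * R).
Proof. exact: measurable_snd. Qed.

Fixpoint mdp_run (pi : policy) (n : nat) : R.-pker (X * R) ~> (X * R)%type :=
  if n is m.+1 then mdp_run pi m \; kpre (mdp_step pi m) meas_cur
  else kdirac meas_id.

(* law of (x_n, c_0 + ... + c_(n-1)) under pi *)
Definition state_law (pi : policy) (n : nat) := mdp_run pi n (init M, 0%R).

Definition value (H : nat) (pi : policy) : \bar R :=
  \int[state_law pi H]_xs (xs.2)%:E.

Let meas_fst2 : measurable_fun setT (fun u : X * R * (X * R) => u.2.1).
Proof. exact: measurableT_comp. Qed.

Let meas_occ : measurable_fun setT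
  (fun u : X * R * (X * R) * A => (u.1.2.1, u.2) : X * A).
Proof. by apply/measurable_fun_pair => //; do 2!apply: measurableT_comp => //. Qed.

Definition occ_kernel (pi : policy) (n : nat) : R.-pker (X * R) ~> (X * A)%type :=
  mdp_run pi n \; (kpre (pi n) meas_fst2 \; kdirac meas_occ).

(* law of (x_n, a_n) under pi *)
Definition occupancy (pi : policy) (n : nat) : set (X * A) -> \bar R :=
  occ_kernel pi n (init M, 0%R).

HB.instance Definition _ pi n := Measure.on (occupancy pi n).
HB.instance Definition _ pi n := Measure_isProbability.Build _ _ _
  (occupancy pi n) (@prob_kernel _ _ _ _ _ (occ_kernel pi n) (init M, 0%R)).

Definition RN_supnorm (d nu : probability (X * A)%type R) : \bar R :=
  if `[< d `<< nu >] then
    'N[nu]_(+oo)['d (charge_of_finite_measure d) '/d nu]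
  else +oo.

Definition concentrability (H : nat) (nu : 'I_H -> probability (X * A)%type R)
    (pi : policy) : \bar R :=
  \big[maxe/-oo]_(h < H) RN_supnorm (occupancy pi h) (nu h).

(* A conditional law on R, as a set function; only its values on measurable
   sets are meaningful. *)
Definition claw := X * A -> set R -> \bar R.

Definition bellman (pi : policy) (h : nat) (q : claw) : claw := fun xa B =>
  \int[cost M h xa]_c \int[trans M h xa]_x' \int[pi h.+1 x']_a'
    q (x', a') [set y | B (c + y)%R].

Definition claw0 : claw := fun=> \d_(0%R : R).

End mdp.

Section density.
Context dX dA (X : measurableType dX) (A : measurableType dA) (R : realType).
Context (lam : {sigma_finite_measure set R -> \bar R}).
Local Open Scope ereal_scope.

(* X x A -> Delta([0,1]), given by densities with respect to lam *)
Record cdens := CDens {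
  dens :> X * A -> R -> R ;
  measurable_dens : measurable_fun setT (fun u : X * A * R => dens u.1 u.2) ;
  dens_ge0 : forall xa z, (0 <= dens xa z)%R ;
  dens_supp : forall xa z, z \notin `[0%R, 1%R] -> dens xa z = 0%R ;
  dens_int1 : forall xa, \int[lam]_z (dens xa z)%:E = 1 }.

Definition dens_law (g : cdens) : claw X A R :=
  fun xa B => \int[lam]_(z in B) (g xa z)%:E.

Definition dens_mean (g : cdens) (xa : X * A) : \bar R :=
  \int[lam]_z (z * g xa z)%:E.

End density.

Section iid.
Context dO dT (Omega : measurableType dO) (T : measurableType dT) (R : realType).
Context (Pr : probability Omega R) (I : finType).
Local Open Scope ereal_scope.

Definition independent (S : I -> Omega -> T) : Prop :=
  forall (J : {set I}) (B : I -> set T), (forall i, measurable (B i)) ->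
    Pr (\bigcap_(i in [set` J]) S i @^-1` B i) =
    \prod_(i in J) Pr (S i @^-1` B i).

Definition iid (S : I -> Omega -> T) (mu : set T -> \bar R) : Prop :=
  independent S /\
  forall i B, measurable B -> Pr (S i @^-1` B) = mu B.

End iid.

Section pdisco.
Context dX dA dO (X : measurableType dX) (A : measurableType dA)
  (Omega : measurableType dO) (R : realType).
Context (lam : {sigma_finite_measure set R -> \bar R}) (M : mdp X A R).
Context (H N : nat) (hH : (0 < H)%N).
Local Open Scope ereal_scope.

(* F = F_1 x ... x F_H, each F_h being a finite indexed family: an index
   f : {dffun forall h, idx h} stands for (F h (f h))_h. *)
Context (idx : 'I_H -> finType) (F : forall h, idx h -> cdens X A lam).
Local Notation tup := {dffun forall h : 'I_H, idx h}.

(* The convention f_(H+1) = delta_0 is applied to all h >= H. *)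
Definition tup_law (f : tup) (h : nat) : claw X A R :=
  if insub h is Some k then dens_law (F (f k)) else @claw0 _ _ X A R.

Definition class_law (h : nat) : set (claw X A R) :=
  if insub h is Some k then range (fun j : idx k => dens_law (F j))
  else [set @claw0 _ _ X A R].

Definition bellman_complete : Prop :=
  forall (pi : policy X A R) (h : 'I_H) (q : claw X A R),
    class_law h.+1 q ->
    exists2 g, class_law h g &
      forall xa B, measurable B -> bellman M pi h q xa B = g xa B.

(* law of ((x, a), c, x', y) with (x, a) ~ nu, c ~ C_h(x, a), x' ~ P_h(x, a)
   and y ~ q(x', pi_(h+1)(x')) *)
Definition sample_law (nu : probability (X * A)%type R) (h : nat)
    (pi : policy X A R) (q : claw X A R) (B : set (X * A * R * X * R)) : \bar R :=
  \int[nu]_xa \int[cost M h xa]_c \int[trans M h xa]_x'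
    \int[pi h.+1 x']_a' q (x', a') [set y | B (xa, c, x', y)].

Context (Pi : finType) (pol : Pi -> policy X A R).
Context (D : 'I_H -> 'I_N -> Omega -> X * A * R * X)
  (y : 'I_H -> tup -> Pi -> 'I_N -> Omega -> R).

(* The samples are i.i.d. over i for each fixed (h, f, p); nothing is assumed
   about the joint law across different (h, f, p). *)
Definition pdisco_sampling (Pr : probability Omega R)
    (nu : 'I_H -> probability (X * A)%type R) : Prop :=
  forall (h : 'I_H) (f : tup) (p : Pi),
    iid Pr (fun i w => (D h i w, y h f p i w))
      (sample_law (nu h) h (pol p) (tup_law f h.+1)).

(* sum_i log g(z_i | x_i, a_i) with z_i = c_i + y_i^(f, p); lne 0 = -oo *)
Definition loglik (w : Omega) (h : 'I_H) (f : tup) (p : Pi) (g : idx h) : \bar R :=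
  \sum_(i < N) let: (xa, c, _) := D h i w in
    lne (F g xa (c + y h f p i w)%R)%:E.

Definition conf_set (beta : R) (w : Omega) (p : Pi) : set tup :=
  [set f | forall h : 'I_H,
     \big[maxe/-oo]_(g : idx h) loglik w f p g - (7 * beta)%:E
       <= loglik w f p (f h)].

(* E_(a ~ pi_1(x_1)) of the mean of f_1(x_1, a) *)
Definition init_mean (p : Pi) (f : tup) : \bar R :=
  \int[pol p 0%N (init M)]_a dens_mean (F (f (Ordinal hH))) (init M, a).

(* phat is an output of the algorithm at w, ties in the argmax and argmin
   being broken arbitrarily; there is none when some confidence set is empty. *)
Definition pdisco_output (beta : R) (w : Omega) (phat : Pi) : Prop :=
  exists fhat : Pi -> tup,
    (forall p, conf_set beta w p (fhat p) /\
       forall f, conf_set beta w p f -> init_mean p f <= init_mean p (fhat p)) /\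
    (forall p, init_mean phat (fhat phat) <= init_mean p (fhat p)).

End pdisco.

(* Main.v *)
Require Import Defs.
From HB Require Import structures.
From mathcomp Require Import all_boot all_order all_algebra.
From mathcomp Require Import all_classical all_reals all_analysis.
From mathcomp Require Import measurable_realfun ess_sup_inf.
From mathcomp Require Import ring lra.
Import Order.TTheory GRing.Theory Num.Theory.
Import numFieldNormedType.Exports.
Local Open Scope classical_set_scope.
Local Open Scope ring_scope.
Local Open Scope ereal_scope.

(* Write W_i for the observation (x_i, a_i, z_i). For a tuple f and a policy,
   the pairs W_i are i.i.d. with law nu(dx, da) g*(z | x, a) lam(dz), where g*
   is a realization in the class of the distributional Bellman target of
   f_(h+1). Since E[sqrt (g / g* ) (W)] is the nu-mean b of the Hellinger
   affinity of g and g*, Markov's inequality gives, off an event of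
   probability (delta / n)^3 with n = H |Pi| |F|,
     prod_i sqrt (g / g* ) (W_i) < exp (3 beta - N (1 - b)).
   There are at most n^3 such events, so all these bounds hold together with
   probability at least 1 - delta. Then the Bellman fixpoint f* of pi is in the
   confidence set (6 beta <= 7 beta), so that f^pi is pessimistic; and every f
   in the confidence set satisfies
     E_nu int (sqrt f_h - sqrt g*_h)^2 <= 13 beta / N.
   Under the comparator, of concentrability C, let u_h be the mean of f_h and
   k_h the mean cost at step h. The target has mean k_h + u_(h+1), and the
   triangle inequality in L^2 for sqrt (z f_h) and sqrt (z g*_h), with z <= 1,
   reads sqrt u_h <= sqrt (k_h + u_(h+1)) + e with e^2 = 13 C beta / N.
   By induction u_1 <= (sqrt V + H e)^2, and 2 sqrt 13 <= 9, 13 <= 30. *)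

Set Implicit Arguments.
Unset Strict Implicit.
Unset Printing Implicit Defensive.

(** * Densities, independence *)

Section density_measure.
Context d (T : measurableType d) (R : realType).
Context (mu : {measure set T -> \bar R}) (f : T -> R).
Context (mf : measurable_fun setT f) (f0 : forall x, (0 <= f x)%R).

(** The two proofs are explicit arguments so that they can be recovered by unification when the
    measure structure is inferred. *)
Definition densm of measurable_fun setT f & (forall x, (0 <= f x)%R) :
  set T -> \bar R := fun B => \int[mu]_(x in B) (f x)%:E.

Let densm0 : densm mf f0 set0 = 0. Proof. exact: integral_set0. Qed.

Let densm_ge0 B : 0 <= densm mf f0 B.
Proof. by apply: integral_ge0 => x _; rewrite lee_fin. Qed.

Let densm_sigma_additive : semi_sigma_additive (densm mf f0).
Proof.
apply: semi_sigma_additive_nng_induced; first exact/measurable_EFinP.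
by move=> x; rewrite lee_fin.
Qed.

HB.instance Definition _ := isMeasure.Build _ _ _ (densm mf f0)
  densm0 densm_ge0 densm_sigma_additive.

Let integral_densm_indic A : measurable A ->
  \int[densm mf f0]_x (\1_A x)%:E = \int[mu]_x (\1_A x * f x)%:E.
Proof.
move=> mA; rewrite integral_indic// setIT /= /densm [LHS]integral_mkcond.
apply: eq_integral => x _; rewrite patchE indicE.
by case: ifPn; rewrite ?mul1r ?mul0r.
Qed.

Import HBNNSimple.

(** Simple functions increase to [phi]; monotone convergence on both sides and linearity reduce the
    claim to indicators, where it is the definition of [densm]. *)
Lemma integral_densm (phi : T -> \bar R) : measurable_fun setT phi ->
  (forall x, 0 <= phi x) ->
  \int[densm mf f0]_x phi x = \int[mu]_x (phi x * (f x)%:E).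
Proof.
move=> mphi phi0; pose h := nnsfun_approx measurableT mphi.
pose m : {measure set T -> \bar R} := [the measure _ _ of densm mf f0].
change (\int[m]_x phi x = \int[mu]_x (phi x * (f x)%:E)).
have hphi x : EFin \o h ^~ x @ \oo --> phi x by exact: cvg_nnsfun_approx.
have mhf n : measurable_fun setT (fun x => (h n x)%:E * (f x)%:E).
  by apply: emeasurable_funM; exact/measurable_EFinP.
transitivity (limn (fun n => \int[m]_x (h n x)%:E)).
  rewrite -monotone_convergence//.
  - by apply: eq_integral => x _; apply/esym/cvg_lim => //; exact: hphi.
  - by move=> n; exact/measurable_EFinP.
  - by move=> n x _; rewrite lee_fin.
  - by move=> x _ a b ab; rewrite lee_fin; exact/lefP/nd_nnsfun_approx.
transitivity (limn (fun n => \int[mu]_x ((h n x)%:E * (f x)%:E))); last first.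
  rewrite -(monotone_convergence mu)//.
  - apply: eq_integral => x _; apply/cvg_lim => //.
    by apply: cvgeZr => //; exact: hphi.
  - by move=> n x _; rewrite mule_ge0 ?lee_fin.
  - move=> x _ a b ab; rewrite lee_wpmul2r ?lee_fin//.
    exact/lefP/nd_nnsfun_approx.
congr (limn _); apply/funext => n.
transitivity (\sum_(k \in range (h n))
    \int[m]_x (k * \1_(h n @^-1` [set k]) x)%:E).
  rewrite -ge0_integral_fsum//.
  - by apply: eq_integral => x _; rewrite fsumEFin// -fimfunE.
  - by move=> r; exact/measurable_EFinP/measurable_funM.
  - by move=> r x _; rewrite nnfun_muleindic_ge0.
transitivity (\sum_(k \in range (h n))
    \int[mu]_x ((k * \1_(h n @^-1` [set k]) x)%:E * (f x)%:E)); last first.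
  rewrite -ge0_integral_fsum//.
  - apply: eq_integral => x _; rewrite [h n x]fimfunE -fsumEFin//.
    rewrite ge0_mule_fsuml// => r.
    exact: nnfun_muleindic_ge0.
  - move=> r; apply: emeasurable_funM; apply/measurable_EFinP => //.
    exact/measurable_funM.
  - move=> r x _; apply: mule_ge0; rewrite ?lee_fin//.
    by have := nnfun_muleindic_ge0 (h n) r x; rewrite lee_fin.
apply: eq_fsbigr => r _.
(* A negative [r] is not a value of [h n], so its level set is empty; a nonnegative one can be
   pulled out of the integrals. *)
have [r0|r0] := ltP r 0%R.
  by rewrite !integral0_eq// => x _; rewrite preimage_nnfun0// indic0 mulr0// mul0e.
under eq_integral do rewrite EFinM.
rewrite ge0_integralZl_EFin//; last exact/measurable_EFinP.
rewrite integral_densm_indic// -ge0_integralZl_EFin//.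
- by apply: eq_integral => x _; rewrite !EFinM muleA.
- by move=> x _; rewrite lee_fin mulr_ge0.
- exact/measurable_EFinP/measurable_funM.
Qed.

End density_measure.

Section transfer.
Context d1 d2 d (T1 : measurableType d1) (T2 : measurableType d2)
  (T : measurableType d) (R : realType).

Definition pushm (mu : {measure set T1 -> \bar R}) (W : T1 -> T)
  (mW : measurable_fun setT W) : {measure set T -> \bar R}.
Proof. refine [the measure _ _ of pushforward mu W]; exact: mW. Defined.

Lemma integral_pushm (mu : {measure set T1 -> \bar R}) (W : T1 -> T)
    (mW : measurable_fun setT W) (phi : T -> \bar R) :
  measurable_fun setT phi -> (forall x, 0 <= phi x) ->
  \int[pushm mu mW]_x phi x = \int[mu]_x phi (W x).
Proof.
move=> mphi phi0; rewrite -[RHS](ge0_integral_pushforward mW mu measurableT)//.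
Qed.

End transfer.

(** Each side integrates [phi] against the image, under [W1] or [W2], of the measure of density [f1]
    or [f2], and the two images agree on measurable sets. This serves to replace one factor of a
    product by its mean, and to pass from [Omega] to a product space. *)
Lemma integral_transfer d1 d2 d (T1 : measurableType d1)
    (T2 : measurableType d2) (T : measurableType d) (R : realType)
    (mu1 : {measure set T1 -> \bar R}) (mu2 : {measure set T2 -> \bar R})
    (W1 : T1 -> T) (W2 : T2 -> T) (f1 : T1 -> R) (f2 : T2 -> R)
    (phi : T -> \bar R) :
  measurable_fun setT W1 -> measurable_fun setT W2 ->
  measurable_fun setT f1 -> measurable_fun setT f2 ->
  (forall x, (0 <= f1 x)%R) -> (forall x, (0 <= f2 x)%R) ->
  (forall B, measurable B -> \int[mu1]_(x in W1 @^-1` B) (f1 x)%:E =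
                             \int[mu2]_(x in W2 @^-1` B) (f2 x)%:E) ->
  measurable_fun setT phi -> (forall x, 0 <= phi x) ->
  \int[mu1]_x (phi (W1 x) * (f1 x)%:E) = \int[mu2]_x (phi (W2 x) * (f2 x)%:E).
Proof.
move=> mW1 mW2 mf1 mf2 f10 f20 mu12 mphi phi0.
rewrite -(integral_densm mu1 mf1 f10 (measurableT_comp mphi mW1))//.
rewrite -(integral_densm mu2 mf2 f20 (measurableT_comp mphi mW2))//.
rewrite -[LHS](integral_pushm _ mW1)// -[RHS](integral_pushm _ mW2)//.
  by apply: eq_measure_integral => B mB _; exact: mu12.
all: by move=> x /=.
Qed.

Section probability_facts.
Context d (T : measurableType d) (R : realType) (P : probability T R).

Lemma le_measure_bigcup_fin (K : finType) (B : K -> set T) :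
  (forall k, measurable (B k)) ->
  P (\bigcup_k B k) <= \sum_(k : K) P (B k).
Proof.
move=> mB.
have -> : \bigcup_k B k = \big[setU/set0]_(k <- index_enum K) B k.
  apply/seteqP; split => x.
    by move=> [k _ Bk]; rewrite -bigcup_seq; exists k => //=; rewrite mem_index_enum.
  by rewrite -bigcup_seq => -[k _ Bk]; exists k.
elim: (index_enum K) => [|k s IH]; first by rewrite !big_nil measure0.
rewrite !big_cons; apply: le_trans (leeD2l _ IH).
by apply: measureU2 => //; apply: bigsetU_measurable.
Qed.

Lemma markov_ge0 (f : T -> R) (a : R) : measurable_fun setT f ->
  (forall x, (0 <= f x)%R) -> (0 < a)%R ->
  a%:E * P [set x | (a <= f x)%R] <= \int[P]_x (f x)%:E.
Proof.
move=> mf f0 a0.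
have := @le_integral_comp_abse _ _ _ P _ measurableT (EFin \o f) a id.
rewrite setTI /= => /(_ _ _ _ _ a0) h.
have -> : [set x | (a <= f x)%R] = [set x | a%:E <= `|(f x)%:E|].
  by apply/seteqP; split => x /=; rewrite lee_fin ger0_norm.
have -> : \int[P]_x (f x)%:E = \int[P]_x `|(f x)%:E|.
  by apply: eq_integral => x _ /=; rewrite ger0_norm.
by apply: h => //; exact/measurable_EFinP.
Qed.

End probability_facts.

Section expectation_of_product.
Context dO dT (Omega : measurableType dO) (T : measurableType dT) (R : realType).
Context (Pr : probability Omega R) (I : finType) (S : I -> Omega -> T).
Hypothesis mS : forall i, measurable_fun setT (S i).
Hypothesis indep : independent Pr S.

Lemma expectation_prod (psi : I -> T -> R) (e : I -> R) :
  (forall i, measurable_fun setT (psi i)) ->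
  (forall i x, (0 <= psi i x)%R) ->
  (forall i, \int[Pr]_w (psi i (S i w))%:E = (e i)%:E) ->
  \int[Pr]_w (\prod_i psi i (S i w))%:E = (\prod_i e i)%:E.
Proof.
(* The list [s] holds the indices at which [psi] may fail to be an indicator. For the empty list the
   claim is the definition of independence; each induction step frees one index. *)
suff main (s : seq I) : forall (psi : I -> T -> R) (e : I -> R),
    (forall i, measurable_fun setT (psi i)) ->
    (forall i x, (0 <= psi i x)%R) ->
    (forall i, \int[Pr]_w (psi i (S i w))%:E = (e i)%:E) ->
    (forall i, i \notin s -> exists2 B, measurable B & psi i = \1_B) ->
    \int[Pr]_w (\prod_i psi i (S i w))%:E = (\prod_i e i)%:E.
  move=> mpsi psi0 psiE; apply: (main (index_enum I)) => // i.
  by rewrite mem_index_enum.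
elim: s => [|j s IH] {psi e} psi e mpsi psi0 psiE psiI.
  have /choice[B BE] : forall i, exists B, measurable B /\ psi i = \1_B.
    by move=> i; have [//|B] := psiI i; exists B.
  have mSB i : measurable (S i @^-1` B i).
    by rewrite -[X in measurable X]setTI; apply: mS => //; case: (BE i).
  have eE i : Pr (S i @^-1` B i) = (e i)%:E.
    rewrite -psiE -[X in Pr X]setIT -integral_indic//.
    by apply: eq_integral => w _; case: (BE i) => _ ->.
  have -> : \int[Pr]_w (\prod_i psi i (S i w))%:E =
      Pr (\bigcap_(i in [set` [set: I]%SET]) S i @^-1` B i).
    have mI : measurable (\bigcap_(i in [set` [set: I]%SET]) S i @^-1` B i).
      by apply: fin_bigcap_measurable.
    rewrite -[X in Pr X]setIT -integral_indic//.
    apply: eq_integral => w _; congr (_%:E); rewrite indicE.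
    have [/set_mem H|/negP H] := boolP (w \in _).
      rewrite big1// => i _; case: (BE i) => _ ->; rewrite indicE mem_set//.
      by apply: H => /=; rewrite finset.in_setT.
    have [i nB] : exists i, ~ (S i @^-1` B i) w.
      apply: contrapT => /forallNP nB; apply: H; apply/mem_set => i _.
      by have /contrapT := nB i.
    rewrite (bigD1 i)//=; case: (BE i) => _ ->; rewrite indicE.
    by rewrite memNset ?mul0r.
  rewrite indep; last by move=> i; case: (BE i).
  rewrite (big_morph EFin EFinM erefl); apply: eq_big => [i|i _] //.
  by rewrite finset.in_setT.
have mpsiS i : measurable_fun setT (psi i \o S i) by exact: measurableT_comp.
pose G w := (\prod_(i | i != j) psi i (S i w))%R.
have mG : measurable_fun setT G.
  rewrite /G; under eq_fun do rewrite -big_filter.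
  by apply: measurable_prod => i _; exact: mpsiS.
have G0 w : (0 <= G w)%R by apply: prodr_ge0.
have e0 i : (0 <= e i)%R.
  by rewrite -lee_fin -psiE; apply: integral_ge0 => w _; rewrite lee_fin.
have c0 : (0 <= \prod_(i | i != j) e i)%R by apply: prodr_ge0.
(* Seen through [S j], the density [G] and the constant product of the other means define the same
   measure: this is the induction hypothesis with [psi j] replaced by the indicator of [B]. *)
have m12 B : measurable B ->
    \int[Pr]_(w in S j @^-1` B) (G w)%:E =
    \int[Pr]_(w in S j @^-1` B) (\prod_(i | i != j) e i)%:E.
  move=> mB.
  have mSB : measurable (S j @^-1` B).
    by rewrite -[X in measurable X]setTI; apply: mS.
  pose psi' i := if i == j then \1_B else psi i.
  pose e' i := if i == j then fine (Pr (S j @^-1` B)) else e i.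
  have prodE (u v : I -> R) : (\prod_i (if i == j then u i else v i) =
      u j * \prod_(i | i != j) v i)%R.
    rewrite (bigD1 j)//= eqxx; congr (_ * _)%R.
    by apply: eq_bigr => i /negbTE ->.
  have -> : \int[Pr]_(w in S j @^-1` B) (\prod_(i | i != j) e i)%:E =
      (fine (Pr (S j @^-1` B)) * \prod_(i | i != j) e i)%:E.
    by rewrite integral_cst// EFinM fineK ?fin_num_measure// muleC.
  rewrite -(prodE (fun=> fine (Pr (S j @^-1` B)))) -(IH psi' e').
  - rewrite integral_mkcond; apply: eq_integral => w _.
    transitivity ((\1_B (S j w) * G w)%:E).
      rewrite patchE indicE; case: ifPn => [/set_mem wB|/negP wB].
        by rewrite mem_set// mul1r.
      by rewrite memNset ?mul0r// => wB'; apply: wB; exact/mem_set.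
    rewrite -[in LHS](prodE (fun=> \1_B (S j w))); congr (_%:E).
    by apply: eq_bigr => i _; rewrite /psi'; case: eqP => [->|].
  - by move=> i; rewrite /psi'; case: ifP.
  - by move=> i x; rewrite /psi'; case: ifP.
  - move=> i; rewrite /psi' /e'; case: eqP => [->|//].
    rewrite fineK ?fin_num_measure// -[X in Pr X]setIT -integral_indic//.
  - move=> i si; rewrite /psi'; case: eqP => [_|/eqP ij]; first by exists B.
    by apply: psiI; rewrite inE negb_or ij.
have mpsij : measurable_fun setT (fun x => (psi j x)%:E) by exact/measurable_EFinP.
transitivity (\int[Pr]_w ((psi j (S j w))%:E * (G w)%:E)).
  by apply: eq_integral => w _; rewrite (bigD1 j).
rewrite (integral_transfer (phi := EFin \o psi j) (mS j) (mS j) mG _ G0 _ m12)//=.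
- under eq_integral do rewrite muleC.
  rewrite ge0_integralZl_EFin//=.
  + by rewrite psiE -EFinM [in RHS](bigD1 j)//= mulrC.
  + by move=> w _; rewrite lee_fin.
  + by apply/measurable_EFinP; exact: mpsiS.
- by move=> x; rewrite lee_fin.
Qed.

End expectation_of_product.

(** * Kernels for the Bellman operator *)

Section integral_support.
Context d (T : measurableType d) (R : realType).

(** Costs and returns lie in [0, 1] only almost surely; identities valid for nonnegative arguments
    enter integrals through this lemma. *)
Lemma eq_integral_supp (mu : {measure set T -> \bar R}) (A : set T)
    (f g : T -> \bar R) :
  measurable A -> mu (~` A) = 0 ->
  measurable_fun setT f -> measurable_fun setT g ->
  (forall x, 0 <= f x) -> (forall x, 0 <= g x) ->
  (forall x, A x -> f x = g x) -> \int[mu]_x f x = \int[mu]_x g x.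
Proof.
move=> mA muA mf mg f0 g0 fg; apply: ge0_ae_eq_integral => //.
exists (~` A); split => //; first exact: measurableC.
by move=> x /= nfg Ax; apply: nfg => _; exact: fg.
Qed.

Lemma integral_cst_prob (mu : {measure set T -> \bar R}) (c : \bar R) :
  mu setT = 1 -> \int[mu]_x c = c.
Proof. by move=> mu1; rewrite integral_cst// mu1 mule1. Qed.

Lemma integral_cstD_prob (mu : {measure set T -> \bar R}) (c : \bar R)
    (f : T -> \bar R) :
  mu setT = 1 -> 0 <= c -> measurable_fun setT f -> (forall x, 0 <= f x) ->
  \int[mu]_x (c + f x) = c + \int[mu]_x f x.
Proof.
by move=> mu1 c0 mf f0; rewrite ge0_integralD// integral_cst_prob.
Qed.

End integral_support.

Section kernel_integrals.
Context d1 d2 d3 (S : measurableType d1) (T : measurableType d2)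
  (U : measurableType d3) (R : realType).

Lemma integral_mkcomp (l : R.-pker S ~> T) (k : R.-pker (S * T)%type ~> U)
    (phi : U -> \bar R) x :
  (forall z, 0 <= phi z) -> measurable_fun setT phi ->
  \int[(l \; k)%E x]_z phi z = \int[l x]_y \int[k (x, y)]_z phi z.
Proof. by move=> phi0 mphi; exact: integral_kcomp. Qed.

Lemma measurable_integral_pker (k : R.-pker S ~> T) (phi : T -> \bar R) :
  (forall z, 0 <= phi z) -> measurable_fun setT phi ->
  measurable_fun setT (fun x => \int[k x]_z phi z).
Proof.
by move=> phi0 mphi; apply: measurable_fun_integral_kernel => //;
  exact: measurable_kernel.
Qed.

Lemma integral_kdirac (f : S -> T) (mf : measurable_fun setT f) x
    (phi : T -> \bar R) :
  measurable_fun setT phi ->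
  \int[kdirac (R := R) mf x]_z phi z = phi (f x).
Proof. by move=> mphi; rewrite integral_dirac// diracT mul1e. Qed.

End kernel_integrals.

Section density_kernel.
Context dX dA (X : measurableType dX) (A : measurableType dA) (R : realType).
Context (lam : {sigma_finite_measure set R -> \bar R}).
Implicit Type g : cdens X A lam.

Lemma measurable_dens_section g xa : measurable_fun setT (g xa).
Proof. exact: measurableT_comp (measurable_dens g) (pair1_measurable xa). Qed.

Definition densk g (xa : X * A) : {measure set R -> \bar R} :=
  [the measure _ _ of densm lam (measurable_dens_section g xa) (dens_ge0 g xa)].

Let measurable_densk g B : measurable B -> measurable_fun setT (densk g ^~ B).
Proof.
move=> mB; rewrite /densk/= /densm.
under eq_fun do rewrite integral_mkcond.
pose f (u : (X * A) * R) := (\1_B u.2 * g u.1 u.2)%:E.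
rewrite (_ : (fun _ => _) = fubini_F lam f); last first.
  apply/funext => xa; apply: eq_integral => z _; rewrite patchE /f/= indicE.
  by case: ifPn; rewrite ?mul1r ?mul0r.
apply: measurable_fun_fubini_tonelli_F.
  apply/measurable_EFinP/measurable_funM; last exact: measurable_dens.
  by apply: measurableT_comp => //; exact: measurable_indic.
by move=> u; rewrite /f lee_fin mulr_ge0// dens_ge0.
Qed.

HB.instance Definition _ g := isKernel.Build _ _ _ _ _ (densk g)
  (@measurable_densk g).

Let densk_prob g xa : densk g xa setT = 1.
Proof. exact: dens_int1. Qed.

HB.instance Definition _ g := Kernel_isProbability.Build _ _ _ _ _
  (densk g) (@densk_prob g).

Lemma integral_densk g xa (phi : R -> \bar R) :
  measurable_fun setT phi -> (forall z, 0 <= phi z) ->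
  \int[densk g xa]_z phi z = \int[lam]_z (phi z * (g xa z)%:E).
Proof. by move=> mphi phi0; rewrite integral_densm. Qed.

Lemma densk_supp g xa : densk g xa (~` `[0%R, 1%R]) = 0.
Proof.
rewrite /densk/= /densm integral0_eq// => z /= /negP z01.
by rewrite dens_supp.
Qed.

End density_kernel.

Section bellman_kernel.
Context dX dA (X : measurableType dX) (A : measurableType dA) (R : realType).
Context (M : mdp X A R).
Implicit Type k : R.-pker (X * A)%type ~> R.

(* The absolute value, harmless for laws supported by [0, 1], keeps the
   integrand nonnegative everywhere. *)
Definition kmean k (xa : X * A) : \bar R := \int[k xa]_z `|z|%:E.

Lemma measurable_normE : measurable_fun setT (fun z : R => `|z|%:E).
Proof. by apply/measurable_EFinP; exact: normr_measurable. Qed.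

Lemma measurable_kmean k : measurable_fun setT (kmean k).
Proof.
by apply: measurable_integral_pker => //; exact: measurable_normE.
Qed.

Lemma kmean_ge0 k xa : 0 <= kmean k xa.
Proof. by apply: integral_ge0 => z _; rewrite lee_fin. Qed.

Lemma kmean_le1 k xa : k xa (~` `[0%R, 1%R]) = 0 -> kmean k xa <= 1.
Proof.
move=> k01; rewrite -[leRHS](@integral_cst_prob _ _ _ (k xa)) ?prob_kernel//.
rewrite /kmean.
(* Truncation at 1 changes nothing on the support and makes the integrand at most 1 everywhere. *)
have -> : \int[k xa]_z `|z|%:E = \int[k xa]_z (Num.min `|z| 1)%:E.
  apply: eq_integral_supp k01 _ _ _ _ _ => //.
  - exact: measurable_normE.
  - by apply/measurable_EFinP; apply: measurable_minr.
  - move=> z /=; rewrite in_itv/= => /andP[z0 z1].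
    by rewrite ger0_norm// min_l.
apply: ge0_le_integral => //.
- by apply/measurable_EFinP; apply: measurable_minr.
- by move=> z _; rewrite lee_fin ge_min lexx orbT.
Qed.

Let m_act : measurable_fun setT (snd : X * A * R * X -> X).
Proof. exact: measurable_snd. Qed.

Let m_dens : measurable_fun setT
  (fun u : X * A * R * X * A => (u.1.2, u.2) : X * A).
Proof. by apply/measurable_fun_pair => //; exact: measurableT_comp. Qed.

Let m_sum : measurable_fun setT
  (fun u : X * A * R * X * A * R => (u.1.1.1.2 + u.2)%R : R).
Proof.
by apply: measurable_funD => //; do 3!apply: measurableT_comp => //.
Qed.

Let m_trans : measurable_fun setT (fst : X * A * R -> X * A).
Proof. exact: measurable_fst. Qed.

(** [bellman] yields a bare set function. A composition of kernels with the same values is a genuine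
    probability kernel, with measurability and iterated integrals at hand. The cost [c] remains in
    the source because it is added only at the end. *)
Definition bellman_tail (pi : policy X A R) h k :
    R.-pker (X * A * R)%type ~> R :=
  kpre (trans M h) m_trans \; (kpre (pi h.+1) m_act \;
    (kpre k m_dens \; kdirac m_sum)).

Definition bellk (pi : policy X A R) h k : R.-pker (X * A)%type ~> R :=
  cost M h \; bellman_tail pi h k.

Lemma bellkE pi h k xa B : measurable B ->
  bellk pi h k xa B = bellman M pi h (fun xa => k xa) xa B.
Proof.
move=> mB; rewrite /bellk /bellman_tail /bellman /=.
rewrite /mkcomp /kcomp; apply: eq_integral => c _.
apply: eq_integral => x' _; apply: eq_integral => a' _.
have mcB : measurable [set y | B (c + y)%R].
  rewrite -[X in measurable X]setTI.
  have mc : measurable_fun setT (fun y : R => (c + y)%R) by exact: measurable_funD.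
  exact: mc.
transitivity (\int[k (x', a')]_y (\1_[set y | B (c + y)%R] y)%:E) => //.
by rewrite integral_indic// setIT.
Qed.

Lemma integral_bellman_tail pi h k xa c (phi : R -> \bar R) :
  (forall z, 0 <= phi z) -> measurable_fun setT phi ->
  \int[bellman_tail pi h k (xa, c)]_z phi z =
  \int[trans M h xa]_x' \int[pi h.+1 x']_a' \int[k (x', a')]_y phi (c + y)%R.
Proof.
move=> phi0 mphi; rewrite integral_mkcomp//; apply: eq_integral => x' _.
rewrite integral_mkcomp//; apply: eq_integral => a' _.
rewrite integral_mkcomp//; apply: eq_integral => y _.
by rewrite integral_kdirac.
Qed.

(** Linearity of expectation for [c + y]. The supports in [0, 1] make both terms nonnegative almost
    surely, so their absolute values add up. *)
Lemma kmean_bellk pi h k xa :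
  cost M h xa (~` `[0%R, 1%R]) = 0 ->
  (forall xa, k xa (~` `[0%R, 1%R]) = 0) ->
  kmean (bellk pi h k) xa = kmean (cost M h) xa +
    \int[trans M h xa]_x' \int[pi h.+1 x']_a' kmean k (x', a').
Proof.
move=> c01 k01.
have n0 (z : R) : 0 <= `|z|%:E by rewrite lee_fin.
have mkpi : measurable_fun setT (fun x' => \int[pi h.+1 x']_a' kmean k (x', a')).
  apply: (measurable_fun_integral_finite_kernel (kmean k)) => //.
    exact: kmean_ge0.
  exact: measurable_kmean.
have mtail : measurable_fun setT
    (fun u => \int[bellman_tail pi h k u]_z `|z|%:E).
  by apply: measurable_integral_pker => //; exact: measurable_normE.
rewrite {1}/kmean integral_mkcomp//; last exact: measurable_normE.
set T := \int[trans M h xa]_x' _.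
have T0 : 0 <= T.
  by do 2!apply: integral_ge0 => ? _; exact: kmean_ge0.
transitivity (\int[cost M h xa]_c (`|c|%:E + T)); last first.
  rewrite ge0_integralD//; last exact: measurable_normE.
  by rewrite integral_cst_prob// prob_kernel.
apply: eq_integral_supp c01 _ _ _ _ _ => //.
- exact: measurableT_comp mtail (pair1_measurable xa).
- by apply: emeasurable_funD => //; exact: measurable_normE.
- by move=> c; apply: integral_ge0.
- by move=> c; rewrite adde_ge0.
move=> c /=; rewrite in_itv/= => /andP[c0 _].
rewrite integral_bellman_tail//; last exact: measurable_normE.
rewrite /T -integral_cstD_prob//; last 2 first.
- exact: prob_kernel.
- by move=> x; apply: integral_ge0 => ? _; exact: kmean_ge0.
apply: eq_integral => x' _.
rewrite -integral_cstD_prob//; last 3 first.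
- exact: prob_kernel.
- exact: measurableT_comp (measurable_kmean k) (pair1_measurable x').
- by move=> x; exact: kmean_ge0.
apply: eq_integral => a' _.
rewrite -integral_cstD_prob//; last 2 first.
- exact: prob_kernel.
- exact: measurable_normE.
apply: eq_integral_supp (k01 (x', a')) _ _ _ _ _ => //.
- apply: measurableT_comp measurable_normE _.
  exact: measurable_funD.
- by apply: emeasurable_funD => //; exact: measurable_normE.
- by move=> z; rewrite adde_ge0.
- move=> y /=; rewrite in_itv/= => /andP[y0 _].
  by rewrite -EFinD !ger0_norm// addr_ge0.
Qed.

End bellman_kernel.

(** * Occupancy measures *)

Section occupancy_measures.
Context dX dA (X : measurableType dX) (A : measurableType dA) (R : realType).
Context (M : mdp X A R) (pi : policy X A R).
Implicit Type k : R.-pker (X * A)%type ~> R.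

Lemma measurable_integral_policy n (phi : X * A -> \bar R) :
  (forall z, 0 <= phi z) -> measurable_fun setT phi ->
  measurable_fun setT (fun x => \int[pi n x]_a phi (x, a)).
Proof.
by move=> phi0 mphi; apply: (measurable_fun_integral_finite_kernel phi).
Qed.

Lemma integral_mdp_step h x s (phi : X * R -> \bar R) :
  (forall z, 0 <= phi z) -> measurable_fun setT phi ->
  \int[mdp_step M pi h (x, s)]_u phi u =
  \int[pi h x]_a \int[cost M h (x, a)]_c \int[trans M h (x, a)]_x'
    phi (x', (s + c)%R).
Proof.
move=> phi0 mphi; rewrite integral_mkcomp//; apply: eq_integral => a _.
rewrite integral_mkcomp//; apply: eq_integral => c _.
rewrite integral_mkcomp//; apply: eq_integral => x' _.
by rewrite integral_kdirac.
Qed.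

Lemma integral_mdp_step_snd h x s (psi : R -> \bar R) :
  (forall z, 0 <= psi z) -> measurable_fun setT psi ->
  \int[mdp_step M pi h (x, s)]_u psi u.2 =
  \int[pi h x]_a \int[cost M h (x, a)]_c psi (s + c)%R.
Proof.
move=> psi0 mpsi; rewrite (integral_mdp_step _ _ _ (phi := psi \o snd))//=.
  apply: eq_integral => a _; apply: eq_integral => c _.
  by rewrite integral_cst_prob// prob_kernel.
exact: measurableT_comp.
Qed.

Lemma integral_state_lawS n (phi : X * R -> \bar R) :
  (forall z, 0 <= phi z) -> measurable_fun setT phi ->
  \int[state_law M pi n.+1]_u phi u =
  \int[state_law M pi n]_v \int[mdp_step M pi n v]_u phi u.
Proof. by move=> phi0 mphi; rewrite /state_law/= integral_mkcomp. Qed.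

Lemma integral_occupancy n (phi : X * A -> \bar R) :
  (forall z, 0 <= phi z) -> measurable_fun setT phi ->
  \int[occupancy M pi n]_xa phi xa =
  \int[state_law M pi n]_v \int[pi n v.1]_a phi (v.1, a).
Proof.
move=> phi0 mphi.
transitivity (\int[occ_kernel M pi n (init M, 0%R)]_xa phi xa) => //.
rewrite integral_mkcomp//; apply: eq_integral => v _.
rewrite integral_mkcomp//; apply: eq_integral => a _.
by rewrite integral_kdirac.
Qed.

Lemma integral_occupancy0 (phi : X * A -> \bar R) :
  (forall z, 0 <= phi z) -> measurable_fun setT phi ->
  \int[occupancy M pi 0]_xa phi xa = \int[pi 0%N (init M)]_a phi (init M, a).
Proof.
move=> phi0 mphi; rewrite integral_occupancy// /state_law /= integral_kdirac//.
exact: measurableT_comp (measurable_integral_policy 0 phi0 mphi) measurable_fst.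
Qed.

(** The next state ignores the cost just incurred, so the integral over [c] is that of a constant,
    and a recursion on the laws of state-action pairs alone remains. *)
Lemma integral_occupancyS n (phi : X * A -> \bar R) :
  (forall z, 0 <= phi z) -> measurable_fun setT phi ->
  \int[occupancy M pi n.+1]_xa phi xa =
  \int[occupancy M pi n]_xa \int[trans M n xa]_x' \int[pi n.+1 x']_a'
    phi (x', a').
Proof.
move=> phi0 mphi.
have mpi := measurable_integral_policy n.+1 phi0 mphi.
have pi0 x : 0 <= \int[pi n.+1 x]_a phi (x, a) by exact: integral_ge0.
rewrite integral_occupancy// integral_state_lawS//; last first.
  exact: measurableT_comp mpi measurable_fst.
rewrite [RHS]integral_occupancy//; last 2 first.
- by move=> xa; exact: integral_ge0.
- exact: measurable_integral_pker.
apply: eq_integral => -[x s] _.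
rewrite (integral_mdp_step _ _ _
  (phi := fun u => \int[pi n.+1 u.1]_a phi (u.1, a)))//=; last first.
  exact: measurableT_comp mpi measurable_fst.
apply: eq_integral => a _.
by rewrite integral_cst_prob// prob_kernel.
Qed.

(** Averaging the one-step identity over the occupancy at [h] moves the continuation to the
    occupancy at [h.+1]; this lets means unroll along the policy. *)
Lemma integral_occupancy_kmean_bellk h k :
  (forall xa, cost M h xa (~` `[0%R, 1%R]) = 0) ->
  (forall xa, k xa (~` `[0%R, 1%R]) = 0) ->
  \int[occupancy M pi h]_xa kmean (bellk M pi h k) xa =
  \int[occupancy M pi h]_xa kmean (cost M h) xa +
  \int[occupancy M pi h.+1]_xa kmean k xa.
Proof.
move=> c01 k01.
have mk := measurable_integral_policy h.+1 (kmean_ge0 k) (measurable_kmean k).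
have k0 x : 0 <= \int[pi h.+1 x]_a kmean k (x, a).
  by apply: integral_ge0 => a _; exact: kmean_ge0.
rewrite integral_occupancyS//; last 2 first.
- exact: kmean_ge0.
- exact: measurable_kmean.
rewrite -ge0_integralD//; last 4 first.
- by move=> xa _; exact: kmean_ge0.
- exact: measurable_kmean.
- by move=> xa _; exact: integral_ge0.
- exact: measurable_integral_pker.
by apply: eq_integral => xa _; rewrite kmean_bellk.
Qed.

Lemma integral_kmean_le1 (mu : probability (X * A)%type R) k :
  (forall xa, k xa (~` `[0%R, 1%R]) = 0) -> \int[mu]_xa kmean k xa <= 1.
Proof.
move=> k01; rewrite -[leRHS](integral_cst_prob _ (probability_setT mu)).
apply: ge0_le_integral => //.
- by move=> xa _; exact: kmean_ge0.
- exact: measurable_kmean.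
- by move=> xa _; exact: kmean_le1.
Qed.

Context (H : nat).
Hypothesis cost_supp : forall (h : nat) (xa : X * A), (h < H)%N ->
  cost M h xa (~` `[0%R, 1%R]) = 0.

Let meas_nneg : measurable [set v : X * R | (0 <= v.2)%R].
Proof.
have := @measurable_snd _ _ X R measurableT `[0%R, +oo[%classic.
rewrite setTI => /(_ (measurable_itv _)); congr measurable.
by apply/seteqP; split => v /=; rewrite in_itv/= andbT.
Qed.

Lemma state_law_ge0 n : (n <= H)%N ->
  state_law M pi n (~` [set v | (0 <= v.2)%R]) = 0.
Proof.
elim: n => [_|n IH nH].
  by rewrite /state_law/= /kdirac/= diracE memNset//=; apply.
set B := [set v : X * R | (0 <= v.2)%R].
have mB : measurable (~` B) by exact: measurableC.
(* The event is tested through the accumulated cost alone, so that the next state integrates out. *)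
pose psi (z : R) : \bar R := (z < 0)%R%:R%:E.
have mpsi : measurable_fun setT psi.
  rewrite (_ : psi = fun z => (\1_(`]-oo, 0%R[%classic : set R) z)%:E).
    by apply/measurable_EFinP; apply: measurable_indic.
  apply/funext => z; rewrite /psi indicE; congr ((nat_of_bool _)%:R%:E).
  by apply/idP/idP; rewrite ?inE/= ?in_itv/=.
have psi0 z : 0 <= psi z by rewrite lee_fin.
rewrite -[X in state_law _ _ _ X]setIT -integral_indic//.
transitivity (\int[state_law M pi n.+1]_u psi u.2).
  apply: eq_integral => u _; rewrite /psi indicE; congr ((nat_of_bool _)%:R%:E).
  apply/idP/idP; first by rewrite inE/= /B/= ltNge => /negP.
  by rewrite ltNge inE/= /B/= => /negP.
rewrite integral_state_lawS//; last exact: measurableT_comp.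
rewrite (eq_integral_supp (g := cst 0) meas_nneg (IH (ltnW nH)))//.
- by rewrite integral0.
- apply: measurable_integral_pker => //; exact: measurableT_comp.
- by move=> v; exact: integral_ge0.
move=> [x s] /= s0; rewrite integral_mdp_step_snd//.
rewrite integral0_eq// => a _.
rewrite (eq_integral_supp (g := cst 0) _ (cost_supp (x, a) nH))//.
- by rewrite integral0.
- apply: measurableT_comp => //; exact: measurable_funD.
- move=> c /=; rewrite in_itv/= => /andP[c0 _].
  by rewrite /psi ltNge addr_ge0.
Qed.

(** Off a null set the accumulated cost and the new cost are nonnegative, so each step adds exactly
    the mean cost under the occupancy. With the absolute value, integrals of nonnegative functions
    suffice. *)
Lemma integral_norm_state_law n : (n <= H)%N ->
  \int[state_law M pi n]_v `|v.2|%:E =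
  \sum_(t < n) \int[occupancy M pi t]_xa kmean (cost M t) xa.
Proof.
elim: n => [_|n IH nH].
  rewrite big_ord0 /state_law/= integral_kdirac/= ?normr0//.
  by apply: (measurableT_comp (@measurable_normE R)).
have mn : measurable_fun setT (fun v : X * R => `|v.2|%:E).
  by apply: (measurableT_comp (@measurable_normE R)).
have mc := measurable_integral_policy n (kmean_ge0 (cost M n))
  (measurable_kmean (cost M n)).
have mc' : measurable_fun setT
    (fun v : X * R => \int[pi n v.1]_a kmean (cost M n) (v.1, a)).
  exact: measurableT_comp mc measurable_fst.
have c0 x : 0 <= \int[pi n x]_a kmean (cost M n) (x, a).
  by apply: integral_ge0 => a _; exact: kmean_ge0.
rewrite big_ord_recr/= -IH ?(ltnW nH)// integral_state_lawS//.
rewrite integral_occupancy//; last 2 first.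
- exact: kmean_ge0.
- exact: measurable_kmean.
rewrite -ge0_integralD//.
apply: (eq_integral_supp meas_nneg (state_law_ge0 (ltnW nH))) => //.
- exact: measurable_integral_pker.
- exact: emeasurable_funD.
- by move=> v; exact: integral_ge0.
- by move=> v; rewrite adde_ge0.
move=> [x s] /= s0.
rewrite (integral_mdp_step_snd _ _ _ (psi := fun z => `|z|%:E))//; last first.
  exact: measurable_normE.
rewrite -integral_cstD_prob//; last 3 first.
- exact: prob_kernel.
- exact: measurableT_comp (measurable_kmean _) (pair1_measurable x).
- by move=> a; exact: kmean_ge0.
apply: eq_integral => a _.
rewrite -integral_cstD_prob//; last 2 first.
- exact: prob_kernel.
- exact: measurable_normE.
apply: (eq_integral_supp _ (cost_supp (x, a) nH)) => //.
- apply: (measurableT_comp (@measurable_normE R)).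
  exact: measurable_funD.
- by apply: emeasurable_funD => //; exact: measurable_normE.
- by move=> z; rewrite adde_ge0.
move=> c /=; rewrite in_itv/= => /andP[c0' _].
by rewrite -EFinD !ger0_norm// addr_ge0.
Qed.

Lemma value_sum :
  value M H pi = \sum_(t < H) \int[occupancy M pi t]_xa kmean (cost M t) xa.
Proof.
rewrite -integral_norm_state_law// /value; apply: ae_eq_integral => //.
- exact/measurable_EFinP.
- by apply: (measurableT_comp (@measurable_normE R)).
exists (~` [set v | (0 <= v.2)%R]); split => //.
- exact: measurableC.
- exact: state_law_ge0.
by move=> v /= nv v0; apply: nv => _; rewrite ger0_norm.
Qed.

End occupancy_measures.

(** * Hellinger distance and change of measure *)

Section hellinger.
Context dX dA (X : measurableType dX) (A : measurableType dA) (R : realType).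
Context (lam : {sigma_finite_measure set R -> \bar R}).
Implicit Types g : cdens X A lam.

(** The Bhattacharyya coefficient of the two conditional densities. *)
Definition affinity g1 g2 (xa : X * A) : \bar R :=
  \int[lam]_z (Num.sqrt (g1 xa z) * Num.sqrt (g2 xa z))%:E.

(** The squared Hellinger distance, without the factor 1/2. *)
Definition hellinger g1 g2 (xa : X * A) : \bar R :=
  \int[lam]_z ((Num.sqrt (g1 xa z) - Num.sqrt (g2 xa z)) ^+ 2)%:E.

Let measurable_sqrt_dens g :
  measurable_fun setT (fun u : X * A * R => Num.sqrt (g u.1 u.2)).
Proof.
apply: (measurableT_comp _ (measurable_dens g)).
by apply: continuous_measurable_fun; exact: sqrt_continuous.
Qed.

Let measurable_sqrt_dens1 g xa :
  measurable_fun setT (fun z => Num.sqrt (g xa z)).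
Proof.
exact: measurableT_comp (measurable_sqrt_dens g) (pair1_measurable xa).
Qed.

Lemma affinity_ge0 g1 g2 xa : 0 <= affinity g1 g2 xa.
Proof. by apply: integral_ge0 => z _; rewrite lee_fin mulr_ge0// sqrtr_ge0. Qed.

Lemma hellinger_ge0 g1 g2 xa : 0 <= hellinger g1 g2 xa.
Proof. by apply: integral_ge0 => z _; rewrite lee_fin sqr_ge0. Qed.

Lemma measurable_affinity g1 g2 : measurable_fun setT (affinity g1 g2).
Proof.
apply: (measurable_fun_fubini_tonelli_F
  (fun u => (Num.sqrt (g1 u.1 u.2) * Num.sqrt (g2 u.1 u.2))%:E)).
  by apply/measurable_EFinP; exact: measurable_funM.
by move=> u; rewrite lee_fin mulr_ge0// sqrtr_ge0.
Qed.

Lemma measurable_hellinger g1 g2 : measurable_fun setT (hellinger g1 g2).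
Proof.
apply: (measurable_fun_fubini_tonelli_F
  (fun u => ((Num.sqrt (g1 u.1 u.2) - Num.sqrt (g2 u.1 u.2)) ^+ 2)%:E)).
  by apply/measurable_EFinP; apply: measurable_funX; exact: measurable_funB.
by move=> u; rewrite lee_fin sqr_ge0.
Qed.

(** Expand the square and use that densities integrate to 1. The additive form avoids subtraction in
    the extended reals. *)
Lemma hellinger_affinity g1 g2 xa :
  hellinger g1 g2 xa + 2%:E * affinity g1 g2 xa = 2%:E.
Proof.
have mg g : measurable_fun setT (EFin \o g xa).
  by apply/measurable_EFinP; exact: measurable_dens_section.
have maff : measurable_fun setT
    (fun z => (Num.sqrt (g1 xa z) * Num.sqrt (g2 xa z))%:E).
  by apply/measurable_EFinP; exact: measurable_funM.
have aff0 z : 0 <= (Num.sqrt (g1 xa z) * Num.sqrt (g2 xa z))%:E.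
  by rewrite lee_fin mulr_ge0// sqrtr_ge0.
have maff2 := measurable_funeM 2%:E maff.
have aff20 z : 0 <= 2%:E * (Num.sqrt (g1 xa z) * Num.sqrt (g2 xa z))%:E.
  by rewrite mule_ge0// lee_fin.
have mhel : measurable_fun setT
    (fun z => ((Num.sqrt (g1 xa z) - Num.sqrt (g2 xa z)) ^+ 2)%:E).
  by apply/measurable_EFinP; apply: measurable_funX; exact: measurable_funB.
have hel0 z : 0 <= ((Num.sqrt (g1 xa z) - Num.sqrt (g2 xa z)) ^+ 2)%:E.
  by rewrite lee_fin sqr_ge0.
have g0 g z : 0 <= (g xa z)%:E by rewrite lee_fin dens_ge0.
rewrite -ge0_integralZl_EFin// -ge0_integralD//.
transitivity (\int[lam]_z ((g1 xa z)%:E + (g2 xa z)%:E)).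
  apply: eq_integral => z _; rewrite -EFinM -!EFinD; congr (_%:E).
  rewrite -[in RHS](sqr_sqrtr (dens_ge0 g1 xa z)).
  by rewrite -[in RHS](sqr_sqrtr (dens_ge0 g2 xa z)); ring.
rewrite ge0_integralD//; [|exact: mg..].
by rewrite !dens_int1.
Qed.

(* [sqrt (|z| g1)] and [sqrt (|z| g2)] differ by at most
   [|sqrt g1 - sqrt g2|] in L^2, since |z| <= 1 on the supports; this is the
   resulting triangle inequality with its square expanded by Young's
   inequality. *)
Lemma kmean_le_hellinger g1 g2 xa (t : R) : (0 < t)%R ->
  kmean (densk g1) xa <= (1 + t)%:E * kmean (densk g2) xa +
                         (1 + t^-1)%:E * hellinger g1 g2 xa.
Proof.
move=> t0; have t10 : (0 <= 1 + t)%R by rewrite addr_ge0// ltW.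
have t20 : (0 <= 1 + t^-1)%R by rewrite addr_ge0// invr_ge0 ltW.
have mg g : measurable_fun setT (fun z : R => `|z|%:E * (g xa z)%:E).
  apply: emeasurable_funM; first exact: measurable_normE.
  by apply/measurable_EFinP; exact: measurable_dens_section.
have g0 g (z : R) : 0 <= `|z|%:E * (g xa z)%:E.
  by rewrite mule_ge0// lee_fin dens_ge0.
have mh : measurable_fun setT
    (fun z => ((Num.sqrt (g1 xa z) - Num.sqrt (g2 xa z)) ^+ 2)%:E).
  by apply/measurable_EFinP; apply: measurable_funX; exact: measurable_funB.
have h0 z : 0 <= ((Num.sqrt (g1 xa z) - Num.sqrt (g2 xa z)) ^+ 2)%:E.
  by rewrite lee_fin sqr_ge0.
have n0 (z : R) : 0 <= `|z|%:E by rewrite lee_fin.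
rewrite /kmean !integral_densk//; [|exact: measurable_normE|exact: measurable_normE].
have mg2 := measurable_funeM (1 + t)%:E (mg g2).
have mh2 := measurable_funeM (1 + t^-1)%:E mh.
have g20 (z : R) : 0 <= (1 + t)%:E * (`|z|%:E * (g2 xa z)%:E).
  by rewrite mule_ge0// lee_fin.
have h20 z : 0 <= (1 + t^-1)%:E *
    ((Num.sqrt (g1 xa z) - Num.sqrt (g2 xa z)) ^+ 2)%:E.
  by rewrite mule_ge0// lee_fin.
rewrite -!ge0_integralZl_EFin// -ge0_integralD//.
apply: ge0_le_integral => //.
  exact: emeasurable_funD.
move=> z _; rewrite -!EFinM -EFinD lee_fin.
have [z01|z01] := boolP (z \in `[0%R, 1%R]); last first.
  by rewrite !dens_supp// subrr expr0n/= !mulr0 addr0.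
move: z01; rewrite in_itv/= => /andP[z0 z1]; rewrite ger0_norm//.
rewrite -{1}[g1 xa z](sqr_sqrtr (dens_ge0 g1 xa z)).
rewrite -{1}[g2 xa z](sqr_sqrtr (dens_ge0 g2 xa z)).
set a := Num.sqrt (g1 xa z); set b := Num.sqrt (g2 xa z).
have young : (a ^+ 2 <= (1 + t) * b ^+ 2 + (1 + t^-1) * (a - b) ^+ 2)%R.
  rewrite -subr_ge0.
  have -> : ((1 + t) * b ^+ 2 + (1 + t^-1) * (a - b) ^+ 2 - a ^+ 2 =
      t^-1 * (t * b - (a - b)) ^+ 2)%R by field; rewrite gt_eqF.
  by rewrite mulr_ge0 ?invr_ge0 ?sqr_ge0// ltW.
apply: (le_trans (ler_wpM2l z0 young)); rewrite mulrDr mulrCA lerD2l.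
by rewrite ler_piMl// mulr_ge0 ?sqr_ge0.
Qed.

End hellinger.

Section concentrability_bound.
Context dX dA (X : measurableType dX) (A : measurableType dA) (R : realType).
Context (d nu : probability (X * A)%type R) (C : R).
Local Open Scope charge_scope.

(** Integrate the derivative over [B] and bound it by its essential supremum. Without absolute
    continuity the norm is [+oo], which contradicts the hypothesis. *)
Lemma RN_supnorm_le_measure : RN_supnorm d nu <= C%:E ->
  forall B, measurable B -> d B <= C%:E * nu B.
Proof.
rewrite /RN_supnorm; case: asboolP => // dnu dC.
have C0 : 0 <= C%:E by apply: le_trans dC; exact: Lnorm_ge0.
(* The norm of infinite exponent unfolds to an essential supremum because [nu] has positive total
   mass. *)
move: dC; rewrite unlock /= probability_setT lte01 => /ess_supP aeC B mB.
set f := 'd _ '/d nu in aeC.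
have mf : measurable_fun setT f.
  by apply: measurable_int; exact: Radon_Nikodym_integrable.
have -> : d B = \int[nu]_(x in B) f x by rewrite -Radon_Nikodym_integral.
apply: (@le_trans _ _ (\int[nu]_(x in B) `|f x|)).
  apply: le_trans (lee_abs _) _; apply: le_abse_integral => //.
  exact: measurable_funTS.
rewrite -integral_cst//; apply: ae_ge0_le_integral => //.
- by apply: measurableT_comp => //; exact: measurable_funTS.
- by apply: filterS aeC => x.
Qed.

Lemma RN_supnorm_ge1 : RN_supnorm d nu <= C%:E -> (1 <= C)%R.
Proof.
move=> /RN_supnorm_le_measure/(_ _ measurableT).
by rewrite !probability_setT mule1 lee_fin.
Qed.

Lemma RN_supnorm_le_integral (phi : X * A -> \bar R) :
  RN_supnorm d nu <= C%:E -> (forall x, 0 <= phi x) ->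
  measurable_fun setT phi ->
  \int[d]_x phi x <= C%:E * \int[nu]_x phi x.
Proof.
move=> dC phi0 mphi.
have C0 : (0 <= C)%R by apply: le_trans (RN_supnorm_ge1 dC).
rewrite -(ge0_integral_mscale nu measurableT (NngNum C0))//.
by apply: ge0_le_measure_integral => //; exact: RN_supnorm_le_measure.
Qed.

End concentrability_bound.

(** * Likelihood ratios *)

Section likelihood_ratio.
Context dX dA dO (X : measurableType dX) (A : measurableType dA)
  (Omega : measurableType dO) (R : realType).
Context (lam : {sigma_finite_measure set R -> \bar R}).
Context (Pr : probability Omega R) (nu : probability (X * A)%type R) (N : nat).
Context (S : 'I_N -> Omega -> X * A * R * X * R).
Context (g0 : cdens X A lam).

(* [(x, a, c, x', y)] is sent to [((x, a), c + y)]. *)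
Definition zsample (u : X * A * R * X * R) : X * A * R :=
  (u.1.1.1, (u.1.1.2 + u.2)%R).

Hypothesis mS : forall i, measurable_fun setT (S i).
Hypothesis indep : independent Pr S.
Hypothesis zlaw : forall i B, measurable B ->
  Pr (S i @^-1` (zsample @^-1` B)) =
  \int[nu]_xa \int[lam]_(z in [set z | B (xa, z)]) (g0 xa z)%:E.

Lemma measurable_zsample : measurable_fun setT zsample.
Proof.
apply/measurable_fun_pair; first by do 2!apply: measurableT_comp => //.
by apply: measurable_funD => //; do 2!apply: measurableT_comp => //.
Qed.

Let W i w := zsample (S i w).

Let mW i : measurable_fun setT (W i).
Proof. exact: measurableT_comp measurable_zsample (mS i). Qed.

Lemma expectation_zsample i (phi : X * A * R -> R) :
  measurable_fun setT phi -> (forall u, (0 <= phi u)%R) ->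
  \int[Pr]_w (phi (W i w))%:E =
  \int[nu]_xa \int[lam]_z (phi (xa, z) * g0 xa z)%:E.
Proof.
move=> mphi phi0.
have mg0 : measurable_fun setT (fun u : X * A * R => g0 u.1 u.2).
  exact: measurable_dens.
have g00 (u : X * A * R) : (0 <= g0 u.1 u.2)%R by exact: dens_ge0.
have mphig : measurable_fun setT (fun u => (phi u * g0 u.1 u.2)%:E).
  by apply/measurable_EFinP; exact: measurable_funM.
transitivity (\int[nu \x lam]_u ((phi u)%:E * (g0 u.1 u.2)%:E)); last first.
  rewrite (fubini_tonelli1 (fun u => (phi u * g0 u.1 u.2)%:E))//.
  by move=> u; rewrite lee_fin mulr_ge0.
(* The weight on the side of [Omega] is the constant 1; on the product space it is the density
   [g0]. *)
transitivity (\int[Pr]_w ((phi (W i w))%:E * (cst 1%R w)%:E)).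
  by apply: eq_integral => w _; rewrite mule1.
apply: (integral_transfer (phi := EFin \o phi) (mW i) (@measurable_id _ _ _)) => //.
- move=> B mB; have mWB : measurable (W i @^-1` B).
    by rewrite -[X in measurable X]setTI; exact: mW.
  transitivity (\int[Pr]_(w in W i @^-1` B) cst 1 w) => //.
  rewrite integral_cst// mul1e [LHS]zlaw//.
  transitivity (\int[nu \x lam]_u ((fun u => (g0 u.1 u.2)%:E) \_ B) u);
    last by rewrite -integral_mkcond.
  rewrite fubini_tonelli1/=; last 2 first.
  - apply/(measurable_restrictT _ _).1 => //.
    by apply: measurable_funTS; exact/measurable_EFinP.
  - by apply: erestrict_ge0 => u _; rewrite lee_fin.
  apply: eq_integral => xa _; rewrite integral_mkcond.
  apply: eq_integral => z _; rewrite !patchE.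
  by congr (if _ then _ else _); apply/idP/idP; rewrite !inE.
- by apply/measurable_EFinP.
Qed.

(** The zero set of [g0] has no mass under the law of density [g0]. Dividing by [g0] along the
    sample is thus harmless. *)
Lemma dens_zsample_gt0 i : exists2 Z, measurable Z &
  Pr Z = 0 /\ forall w, ~ Z w -> (0 < g0 (W i w).1 (W i w).2)%R.
Proof.
have m0 : measurable [set u : X * A * R | g0 u.1 u.2 = 0%R].
  have := measurable_dens g0 measurableT (measurable_set1 0%R).
  by rewrite setTI.
have mZ : measurable (W i @^-1` [set u : X * A * R | g0 u.1 u.2 = 0%R]).
  by rewrite -[X in measurable X]setTI; exact: mW.
exists (W i @^-1` [set u : X * A * R | g0 u.1 u.2 = 0%R]) => //; split.
  apply: (etrans (zlaw i m0)); rewrite integral0_eq// => xa _.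
  by rewrite integral0_eq// => z /= ->.
by move=> w /= /eqP gn0; rewrite lt0r gn0 dens_ge0.
Qed.

Variable g : cdens X A lam.

Definition mean_affinity : R := fine (\int[nu]_xa affinity g g0 xa).

Lemma affinity_le1 xa : affinity g g0 xa <= 1.
Proof.
have : 2%:E * affinity g g0 xa <= 2%:E.
  by rewrite -[leRHS](hellinger_affinity g g0 xa) leeDr// hellinger_ge0.
have := affinity_ge0 g g0 xa; case: (affinity g g0 xa) => [r| |] //.
  by rewrite -EFinM !lee_fin => _ r2; rewrite -(ler_pM2l (@ltr0Sn R 1)) mulr1.
by rewrite mulry gtr0_sg// mul1e.
Qed.

Lemma mean_affinityE : \int[nu]_xa affinity g g0 xa = mean_affinity%:E.
Proof.
have aff0 := affinity_ge0 g g0.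
rewrite /mean_affinity fineK// ge0_fin_numE; last exact: integral_ge0.
apply: (@le_lt_trans _ _ 1); last by rewrite ltry.
rewrite -[leRHS](integral_cst_prob _ (probability_setT nu)).
apply: ge0_le_integral => //; first exact: measurable_affinity.
by move=> xa _; exact: affinity_le1.
Qed.

Lemma mean_affinity_ge0 : (0 <= mean_affinity)%R.
Proof.
by rewrite -lee_fin -mean_affinityE; apply: integral_ge0 => xa _;
  exact: affinity_ge0.
Qed.

Lemma mean_hellinger_affinity :
  \int[nu]_xa hellinger g g0 xa = (2 * (1 - mean_affinity))%:E.
Proof.
have mh := measurable_hellinger g g0; have ma := measurable_affinity g g0.
have h0 := hellinger_ge0 g g0; have a0 := affinity_ge0 g g0.
have : \int[nu]_xa (hellinger g g0 xa + 2%:E * affinity g g0 xa) = 2%:E.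
  under eq_integral do rewrite hellinger_affinity.
  exact: integral_cst_prob _ (probability_setT nu).
have ma2 := measurable_funeM 2%:E ma.
have a20 xa : 0 <= 2%:E * affinity g g0 xa by rewrite mule_ge0.
rewrite ge0_integralD// ge0_integralZl_EFin// mean_affinityE.
rewrite -EFinM; case: (\int[nu]_x hellinger g g0 x) => [r| |] //.
by rewrite -EFinD => -[rE]; congr (_%:E); lra.
Qed.

(* The ratio [g / g0] is [0] where [g0] vanishes, a null event. *)
Definition sqrt_ratio (u : X * A * R) : R :=
  Num.sqrt (g u.1 u.2 / g0 u.1 u.2).

Let measurable_sqrt_ratio : measurable_fun setT sqrt_ratio.
Proof.
apply: measurableT_comp.
  by apply: continuous_measurable_fun; exact: sqrt_continuous.
apply: measurable_funM; first exact: measurable_dens.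
(* On nonnegative reals, including 0, the inverse is the power of exponent -1, which is
   measurable. *)
have -> : (fun u : X * A * R => (g0 u.1 u.2)^-1%R) =
    (fun u : X * A * R => powR (g0 u.1 u.2) (-1)%R).
  by apply/funext => u /=; rewrite powR_inv1// dens_ge0.
exact: measurableT_comp (@measurable_powR R (-1)%R) (measurable_dens g0).
Qed.

Let sqrt_ratio_ge0 u : (0 <= sqrt_ratio u)%R.
Proof. exact: sqrtr_ge0. Qed.

(** [sqrt (g / g0) * g0 = sqrt g * sqrt g0]; where [g0] vanishes both sides are 0. *)
Lemma expectation_sqrt_ratio i :
  \int[Pr]_w (sqrt_ratio (W i w))%:E = mean_affinity%:E.
Proof.
rewrite -mean_affinityE expectation_zsample//.
apply: eq_integral => xa _; apply: eq_integral => z _; congr (_%:E).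
rewrite /sqrt_ratio/= sqrtrM ?dens_ge0// -mulrA; congr (_ * _)%R.
rewrite sqrtrV ?dens_ge0//; set s := g0 xa z.
have [->|s0] := eqVneq s 0%R; first by rewrite mulr0 sqrtr0.
have s0' : (0 <= s)%R by exact: dens_ge0.
rewrite -{2}(sqr_sqrtr s0') expr2 mulrA mulVf ?mul1r// sqrtr_eq0 -ltNge.
by rewrite lt0r s0.
Qed.

Definition ratio_prod (w : Omega) : R := \prod_i sqrt_ratio (W i w).

(** By independence the product has mean [b ^+ N], at most [expR (- (N (1 - b)))], so Markov's
    inequality at [K] times this exponential leaves probability at most [K^-1]. The null events
    where [g0] vanishes at an observation are put into [Bad] as well. *)
Lemma ratio_prod_tail (K : R) : (0 < K)%R -> exists2 Bad, measurable Bad &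
  Pr Bad <= (K^-1)%:E /\ forall w, ~ Bad w ->
    (forall i, (0 < g0 (W i w).1 (W i w).2)%R) /\
    (ratio_prod w < K * expR (- (N%:R * (1 - mean_affinity))))%R.
Proof.
move=> K0; set b := mean_affinity.
have mprod : measurable_fun setT ratio_prod.
  by apply: measurable_prod => i _; exact: measurableT_comp.
have prod0 w : (0 <= ratio_prod w)%R by apply: prodr_ge0.
pose a := (K * expR (- (N%:R * (1 - b))))%R.
have a0 : (0 < a)%R by rewrite mulr_gt0// expR_gt0.
have Eprod : \int[Pr]_w (ratio_prod w)%:E = (b ^+ N)%:E.
  rewrite (expectation_prod mS indep (psi := fun=> sqrt_ratio \o zsample)
    (e := fun=> b))//=; first by rewrite prodr_const card_ord.
  - by move=> _; exact: measurableT_comp measurable_sqrt_ratio measurable_zsample.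
  - by move=> i; exact: expectation_sqrt_ratio.
have := markov_ge0 Pr mprod prod0 a0; rewrite Eprod => tail.
have /choice[Z ZP] : forall i, exists Z, measurable Z /\
    (Pr Z = 0 /\ forall w, ~ Z w -> (0 < g0 (W i w).1 (W i w).2)%R).
  by move=> i; have [Z ? ?] := dens_zsample_gt0 i; exists Z.
have mtail : measurable [set w | (a <= ratio_prod w)%R].
  have := mprod measurableT `[a, +oo[%classic (measurable_itv _).
  rewrite setTI; congr measurable.
  by apply/seteqP; split => w /=; rewrite in_itv/= andbT.
have mZ i : measurable (Z i) by case: (ZP i).
have mUZ : measurable (\bigcup_i Z i) by apply: fin_bigcup_measurable.
have PrZ : Pr (\bigcup_i Z i) = 0.
  apply/eqP; rewrite eq_le measure_ge0 andbT.
  apply: le_trans (le_measure_bigcup_fin Pr mZ) _.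
  by rewrite big1// => i _; case: (ZP i) => _ [].
exists (\bigcup_i Z i `|` [set w | (a <= ratio_prod w)%R]).
  exact: measurableU.
split.
  apply: le_trans (_ : _ <= Pr (\bigcup_i Z i) +
    Pr [set w | (a <= ratio_prod w)%R]) _; first exact: measureU2.
  rewrite [X in X + _]PrZ add0e.
  (* From [1 + x <= expR x] at [x = b - 1], raised to the power [N]. *)
  have bN : (b ^+ N <= expR (- (N%:R * (1 - b))))%R.
    rewrite -mulrN expRM_natl; apply: lerXn2r.
    - by rewrite nnegrE mean_affinity_ge0.
    - by rewrite nnegrE expR_ge0.
    - by apply: le_trans (expR_ge1Dx _); lra.
  have PrE : Pr [set w | (a <= ratio_prod w)%R] \is a fin_num.
    exact: fin_num_measure.
  move: tail; rewrite -(fineK PrE) -EFinM !lee_fin => tail.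
  rewrite -(ler_pM2l a0); apply: (le_trans tail); apply: (le_trans bN).
  by rewrite /a mulrAC mulfV ?gt_eqF// mul1r.
move=> w nBad; split=> [i|].
  by case: (ZP i) => _ [_]; apply => Zw; apply: nBad; left; exists i.
by rewrite ltNge; apply/negP => aw; apply: nBad; right.
Qed.

End likelihood_ratio.

Section log_likelihood.
Context (R : realType) (N : nat).

(** The log-likelihood ratio is twice the logarithm of the product of square roots. If some [G i] is
    0, the left-hand side is [-oo]. *)
Lemma sum_lne_le (G S : 'I_N -> R) (c : R) :
  (forall i, (0 <= G i)%R) -> (forall i, (0 < S i)%R) ->
  (\prod_i Num.sqrt (G i / S i) < expR c)%R ->
  \sum_i lne (G i)%:E <= (\sum_i ln (S i))%:E + (2 * c)%:E.
Proof.
move=> G0 S0 GS.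
have [[i Gi]|nG] := pselect (exists i, G i = 0%R).
  suff -> : \sum_i lne (G i)%:E = -oo by exact: leNye.
  apply/esum_eqNyP; exists i.
  by split; [exact: mem_index_enum|by []|rewrite Gi le0_lneNy].
have {}G0 i : (0 < G i)%R.
  by rewrite lt0r G0 andbT; apply/eqP => Gi; apply: nG; exists i.
under eq_bigr do rewrite lne_EFin//.
rewrite sumEFin -EFinD lee_fin -lerBlDl -sumrB.
have -> : (\sum_i (ln (G i) - ln (S i)) =
    2 * ln (\prod_i Num.sqrt (G i / S i)))%R.
  have lnp (u : 'I_N -> R) : (forall i, 0 < u i)%R ->
      ln (\prod_i u i) = (\sum_i ln (u i))%R.
    move=> u0; suff [] : (0 < \prod_i u i)%R /\
        ln (\prod_i u i) = (\sum_i ln (u i))%R by [].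
    apply: (big_rec2 (fun p s => (0 < p)%R /\ ln p = s)) => [|i s p _ [p0 <-]].
      by rewrite ltr01 ln1.
    by rewrite mulr_gt0// lnM ?posrE.
  rewrite lnp; last by move=> i; rewrite sqrtr_gt0 divr_gt0.
  rewrite mulr_sumr; apply: eq_bigr => i _.
  rewrite -ln_div ?posrE// -{1}(sqr_sqrtr (ltW (divr_gt0 (G0 i) (S0 i)))).
  by rewrite lnXn ?sqrtr_gt0 ?divr_gt0// mulr_natl.
rewrite ler_pM2l// -[leRHS]expRK ler_ln ?posrE ?expR_gt0//; first exact: ltW.
by apply: prodr_gt0 => i _; rewrite sqrtr_gt0 divr_gt0.
Qed.

Lemma sum_lneE (S : 'I_N -> R) : (forall i, (0 < S i)%R) ->
  \sum_i lne (S i)%:E = (\sum_i ln (S i))%:E.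
Proof.
by move=> S0; rewrite -sumEFin; apply: eq_bigr => i _; rewrite lne_EFin.
Qed.

End log_likelihood.

(** * Bellman targets *)

Section model_kernels.
Context dX dA (X : measurableType dX) (A : measurableType dA) (R : realType).
Context (lam : {sigma_finite_measure set R -> \bar R}) (M : mdp X A R) (H : nat).
Context (idx : 'I_H -> finType) (F : forall h, idx h -> cdens X A lam).
Local Notation tup := {dffun forall h : 'I_H, idx h}.
Implicit Types (f : tup) (pi : policy X A R).

Definition tupk f (h : nat) : R.-pker (X * A)%type ~> R :=
  if insub h is Some k then densk (F (f k))
  else kdirac (measurable_cst (0%R : R)).

Lemma tup_lawE f h : tup_law F f h = (fun xa => tupk f h xa).
Proof.
by apply/funext => xa; apply/funext => B; rewrite /tup_law /tupk; case: insub.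
Qed.

Lemma tupk_ord f (h : 'I_H) : tupk f h = densk (F (f h)).
Proof. by rewrite /tupk valK. Qed.

Lemma tupk_supp f h xa : tupk f h xa (~` `[0%R, 1%R]) = 0.
Proof.
rewrite /tupk; case: insub => [k|]; first exact: densk_supp.
rewrite /= /kdirac/= diracE memNset//=; apply.
by rewrite in_itv/= lexx ler01.
Qed.

Lemma kmean_tupk_end f xa : kmean (tupk f H) xa = 0.
Proof.
have kE : tupk f H = kdirac (measurable_cst (0%R : R)).
  by rewrite /tupk insubN// ltnn.
rewrite /kmean kE integral_kdirac ?normr0//.
exact: measurable_normE.
Qed.

Definition is_target pi f (h : 'I_H) (j : idx h) : Prop :=
  forall xa B, measurable B ->
    bellman M pi h (tup_law F f h.+1) xa B = dens_law (F j) xa B.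

Lemma kmean_target pi f (h : 'I_H) (j : idx h) xa : is_target pi f j ->
  kmean (densk (F j)) xa = kmean (bellk M pi h (tupk f h.+1)) xa.
Proof.
move=> jT; apply: eq_measure_integral => B mB _.
by rewrite bellkE// -tup_lawE; rewrite jT.
Qed.

Hypothesis F_complete : bellman_complete M F.

Lemma class_law_ord (h : 'I_H) q : class_law F h q ->
  exists j : idx h, q = dens_law (F j).
Proof. by rewrite /class_law valK => -[j _ <-]; exists j. Qed.

Lemma exists_target pi f h : exists j : idx h, is_target pi f j.
Proof.
have [|g /class_law_ord[j ->] gE] := F_complete pi (h := h) (q := tup_law F f h.+1).
  by rewrite /class_law /tup_law; case: insub => [k|//]; exists (f k).
by exists j.
Qed.

(** Completeness propagates nonemptiness backwards from time [H], where the class consists of the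
    Dirac mass at 0. *)
Lemma idx_inhabited pi (h : 'I_H) : exists j : idx h, True.
Proof.
suff main n : (n <= H)%N -> class_law F (H - n) !=set0.
  have /main[q] : (H - h <= H)%N by rewrite leq_subr.
  by rewrite subKn ?(ltnW (ltn_ord h))// => /class_law_ord[j _]; exists j.
elim: n => [_|n IH nH].
  by rewrite subn0 /class_law insubN ?ltnn//; exists (@claw0 _ _ X A R).
have hH : (H - n.+1 < H)%N by rewrite ltn_subrL/= (leq_trans _ nH).
have [q] := IH (ltnW nH).
rewrite (_ : (H - n)%N = (Ordinal hH).+1); last by rewrite /= subnSK.
by move=> /(F_complete pi)[g gq _]; exists g.
Qed.

(* Backward induction: the component at [h] is chosen once those after [h]
   are. *)
Lemma exists_fixpoint pi : exists f, forall h : 'I_H, is_target pi f (f h).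
Proof.
have [g0 _] : exists g : forall h, idx h, True.
  by exists (fun h => sval (cid (idx_inhabited pi h))).
suff main n : (n <= H)%N -> exists g : forall h, idx h, forall h : 'I_H,
    (H - n <= h)%N -> is_target pi (finfun g) (g h).
  have [g gT] := main H (leqnn H); exists (finfun g) => h.
  by rewrite ffunE; apply: gT; rewrite subnn.
elim: n => [_|n IH nH].
  by exists g0 => h; rewrite subn0 leqNgt ltn_ord.
have hH : (H - n.+1 < H)%N by rewrite ltn_subrL/= (leq_trans _ nH).
have [g gT] := IH (ltnW nH); pose h0 := Ordinal hH.
have [j jT] := exists_target pi (finfun g) h0.
(* Changing the component at [h0] leaves all later laws, hence the targets already met,
   unchanged. *)
have lawE m : (h0 < m)%N ->
    tup_law F (finfun (dfwith g h0 j)) m = tup_law F (finfun g) m.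
  move=> hm; rewrite /tup_law; case: insubP => // k _ km.
  rewrite !ffunE dfwithout//; apply/eqP => h0k.
  by move: hm; rewrite -km h0k ltnn.
exists (dfwith g h0 j) => h hh.
have [<-|h0h] := eqVneq h0 h.
  by move=> xa B mB; rewrite dfwithin lawE// jT.
have h0lt : (h0 < h)%N by rewrite ltn_neqAle hh andbT.
move=> xa B mB; rewrite dfwithout// lawE; last exact: ltnW.
by apply: gT => //; move: h0lt; rewrite /= subnSK.
Qed.

Hypothesis cost_supp : forall (h : nat) (xa : X * A), (h < H)%N ->
  cost M h xa (~` `[0%R, 1%R]) = 0.

Definition step_mean pi f h : \bar R :=
  \int[occupancy M pi h]_xa kmean (tupk f h) xa.

Definition step_cost pi h : \bar R :=
  \int[occupancy M pi h]_xa kmean (cost M h) xa.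

Lemma step_mean_end pi f : step_mean pi f H = 0.
Proof. by apply: integral0_eq => xa _; exact: kmean_tupk_end. Qed.

Lemma step_mean_ge0 pi f h : 0 <= step_mean pi f h.
Proof. by apply: integral_ge0 => xa _; exact: kmean_ge0. Qed.

Lemma step_cost_ge0 pi h : 0 <= step_cost pi h.
Proof. by apply: integral_ge0 => xa _; exact: kmean_ge0. Qed.

Lemma step_mean_fin pi f h : step_mean pi f h \is a fin_num.
Proof.
rewrite ge0_fin_numE ?step_mean_ge0//.
apply: (@le_lt_trans _ _ 1); last by rewrite ltry.
by apply: integral_kmean_le1 => xa; exact: tupk_supp.
Qed.

Lemma step_cost_fin pi h : (h < H)%N -> step_cost pi h \is a fin_num.
Proof.
move=> hH; rewrite ge0_fin_numE ?step_cost_ge0//.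
apply: (@le_lt_trans _ _ 1); last by rewrite ltry.
by apply: integral_kmean_le1 => xa; exact: cost_supp.
Qed.

Lemma target_mean pi f (h : 'I_H) (j : idx h) : is_target pi f j ->
  \int[occupancy M pi h]_xa kmean (densk (F j)) xa =
  step_cost pi h + step_mean pi f h.+1.
Proof.
move=> jT.
have <- := integral_occupancy_kmean_bellk pi (k := tupk f h.+1)
  (fun xa => cost_supp xa (ltn_ord h)) (tupk_supp f h.+1).
by apply: eq_integral => xa _; exact: kmean_target.
Qed.

Lemma init_meanE (hH : (0 < H)%N) (Pi : finType) (pol : Pi -> policy X A R) p f :
  init_mean M hH F pol p f = step_mean (pol p) f 0.
Proof.
rewrite /step_mean integral_occupancy0; last 2 first.
- exact: kmean_ge0.
- exact: measurable_kmean.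
apply: eq_integral => a _; rewrite (tupk_ord f (Ordinal hH)).
rewrite /kmean integral_densk//; last exact: measurable_normE.
apply: eq_integral => z _; rewrite -EFinM; congr (_%:E).
have [|z01] := boolP (z \in `[0%R, 1%R]); last by rewrite !dens_supp// !mulr0.
by rewrite in_itv/= => /andP[z0 _]; rewrite ger0_norm.
Qed.

(** Each component of a fixpoint is its own target, so [target_mean] telescopes over the horizon and
    the predicted mean is the exact value. *)
Lemma step_mean_fixpoint pi f : (forall h : 'I_H, is_target pi f (f h)) ->
  step_mean pi f 0 = value M H pi.
Proof.
move=> fT; rewrite (value_sum pi cost_supp).
suff main n : (n <= H)%N -> step_mean pi f 0 =
    \sum_(t < n) step_cost pi t + step_mean pi f n.
  by rewrite (main H)// step_mean_end adde0.
elim: n => [_|n IH nH]; first by rewrite big_ord0 add0e.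
rewrite (IH (ltnW nH)) big_ord_recr/= -addeA; congr (_ + _).
have := target_mean (fT (Ordinal nH)) => /= <-.
by rewrite /step_mean -[n]/(nat_of_ord (Ordinal nH)) tupk_ord.
Qed.

End model_kernels.

(** * Error propagation over the horizon *)

Section square_root_recursion.
Context (R : realType).
Local Open Scope ring_scope.

(* Optimizing Young's inequality over the weight [t]. *)
Lemma young_inf (u w e : R) : 0 <= w -> 0 < e ->
  (forall t, 0 < t -> u <= (1 + t) * w + (1 + t^-1) * e ^+ 2) ->
  u <= (Num.sqrt w + e) ^+ 2.
Proof.
move=> w0 e0 yng; have e20 : 0 < e ^+ 2 by rewrite exprn_gt0.
have [w00|wn0] := eqVneq w 0.
  rewrite w00 sqrtr0 add0r leNgt; apply/negP => ue.
  have ue0 : 0 < u - e ^+ 2 by rewrite subr_gt0.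
  (* For [w = 0] the infimum is only approached as [t] grows; this [t] gives
     [u <= e ^+ 2 + (u - e ^+ 2) / 2], contradicting [e ^+ 2 < u]. *)
  pose t := 2 * e ^+ 2 / (u - e ^+ 2).
  have t0 : 0 < t by rewrite divr_gt0// mulr_gt0.
  have := yng t t0; rewrite w00 mulr0 add0r invf_div.
  rewrite (_ : (1 + (u - e ^+ 2) / (2 * e ^+ 2)) * e ^+ 2 =
    e ^+ 2 + (u - e ^+ 2) / 2); last by field; rewrite gt_eqF.
  by lra.
have {wn0 w0} w0 : 0 < w by rewrite lt0r wn0.
set s := Num.sqrt w; have s0 : 0 < s by rewrite sqrtr_gt0.
(* The minimizing weight. *)
have := yng (e / s) (divr_gt0 e0 s0).
rewrite -[X in _ * X + _](sqr_sqrtr (ltW w0)) -/s invf_div.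
have -> : (1 + e / s) * s ^+ 2 + (1 + s / e) * e ^+ 2 = (s + e) ^+ 2.
  by field; rewrite !gt_eqF.
by [].
Qed.

(** Induction on the horizon, with the sequences shifted by one. With [V = k 0 + V'], the step
    amounts to [k 0 + (sqrt V' + H e)^2 <= (sqrt V + H e)^2], where only the cross terms differ and
    the square root is monotone. *)
Lemma sqrt_recursion (H : nat) (u k : nat -> R) (e : R) : 0 < e ->
  (forall h, 0 <= k h) -> (forall h, 0 <= u h) -> u H = 0 ->
  (forall h t, (h < H)%N -> 0 < t ->
    u h <= (1 + t) * (k h + u h.+1) + (1 + t^-1) * e ^+ 2) ->
  u 0%N <= (Num.sqrt (\sum_(h < H) k h) + H%:R * e) ^+ 2.
Proof.
move=> e0; elim: H u k => [|H IH] u k k0 u0 uH urec.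
  by rewrite uH sqr_ge0.
have V0 : 0 <= \sum_(h < H) k h.+1 by apply: sumr_ge0.
have He : 0 <= H%:R * e by rewrite mulr_ge0// ltW.
have u1 := IH (u \o succn) (k \o succn) (fun h => k0 h.+1) (fun h => u0 h.+1) uH
  (fun h t => urec h.+1 t).
rewrite /= in u1; set V' := \sum_(h < H) k h.+1 in V0 u1.
rewrite big_ord_recl (_ : \sum_(i < H) _ = V')//; set V := k ord0 + V'.
have V'V : V' <= V by rewrite lerDr.
have u0le := young_inf (addr_ge0 (k0 0%N) (u0 1%N)) e0 (fun t => urec 0%N t erefl).
apply: (le_trans u0le); rewrite lerXn2r ?nnegrE//.
- by rewrite addr_ge0 ?sqrtr_ge0// ltW.
- by rewrite addr_ge0 ?sqrtr_ge0// mulr_ge0// ltW.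
rewrite -natr1 mulrDl mul1r addrA lerD2r.
have VHe : 0 <= Num.sqrt V + H%:R * e by rewrite addr_ge0 ?sqrtr_ge0.
rewrite -[leRHS](ger0_norm VHe) -sqrtr_sqr ler_sqrt ?sqr_ge0//.
apply: (le_trans (lerD (lexx (k 0%N)) u1)).
rewrite !sqrrD !sqr_sqrtr//; last exact: le_trans V'V.
have : Num.sqrt V' * (H%:R * e) <= Num.sqrt V * (H%:R * e).
  by rewrite ler_wpM2r// ler_sqrt// (le_trans V0).
move: (Num.sqrt V' * _) (Num.sqrt V * _) => x y xy.
have -> : V = k 0%N + V' by [].
by lra.
Qed.

End square_root_recursion.

(** * Confidence sets *)

Section pdisco_analysis.
Context dX dA dO (X : measurableType dX) (A : measurableType dA)
  (Omega : measurableType dO) (R : realType).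
Context (lam : {sigma_finite_measure set R -> \bar R}) (M : mdp X A R).
Context (H N : nat) (hH : (0 < H)%N) (hN : (0 < N)%N).
Context (idx : 'I_H -> finType) (F : forall h, idx h -> cdens X A lam).
Local Notation tup := {dffun forall h : 'I_H, idx h}.
Context (Pi : finType) (pol : Pi -> policy X A R) (Pr : probability Omega R)
  (nu : 'I_H -> probability (X * A)%type R).
Context (D : 'I_H -> 'I_N -> Omega -> X * A * R * X)
  (y : 'I_H -> tup -> Pi -> 'I_N -> Omega -> R).

Let S h f p i w : X * A * R * X * R := (D h i w, y h f p i w).

Definition zobs h f p i w : X * A * R := zsample (S h f p i w).

Lemma loglikE w (h : 'I_H) f p (g : idx h) : loglik F D y w f p g =
  \sum_(i < N) lne (F g (zobs h f p i w).1 (zobs h f p i w).2)%:E.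
Proof.
apply: eq_bigr => i _; rewrite /zobs /zsample /S/=.
by case: (D h i w) => -[[xa c] x'].
Qed.

(* All realizations [j] of the Bellman target are needed: a density is only
   determined lam-almost everywhere. *)
Definition good_sample (beta : R) (w : Omega) : Prop :=
  forall (h : 'I_H) (f : tup) (p : Pi) (g j : idx h),
    is_target M F (pol p) f j ->
    (forall i, (0 < F j (zobs h f p i w).1 (zobs h f p i w).2)%R) /\
    (\prod_(i < N) Num.sqrt (F g (zobs h f p i w).1 (zobs h f p i w).2 /
                             F j (zobs h f p i w).1 (zobs h f p i w).2) <
     expR (3 * beta - N%:R * (1 - mean_affinity (nu h) (F j) (F g))))%R.

Lemma tup_component (f : tup) (h : 'I_H) (g : idx h) : exists f' : tup, f' h = g.
Proof. by exists (finfun (dfwith f h g)); rewrite ffunE dfwithin. Qed.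

Lemma mean_affinity_le1 (h : 'I_H) (g j : idx h) :
  (mean_affinity (nu h) (F j) (F g) <= 1)%R.
Proof.
have : 0 <= \int[nu h]_xa hellinger (F g) (F j) xa.
  by apply: integral_ge0 => xa _; exact: hellinger_ge0.
by rewrite mean_hellinger_affinity lee_fin; lra.
Qed.

(** The excess over the target is at most [6 * beta] minus [N] times the mean squared Hellinger
    distance. Dropping the last term puts the fixpoint in the confidence set; keeping it controls
    every member of that set. *)
Lemma loglik_le beta w (h : 'I_H) f p (g j : idx h) :
  good_sample beta w -> is_target M F (pol p) f j ->
  loglik F D y w f p g <= loglik F D y w f p j +
    (2 * (3 * beta - N%:R * (1 - mean_affinity (nu h) (F j) (F g))))%:E.
Proof.
move=> good jT; have [j0 ratio] := good h f p g j jT.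
rewrite !loglikE (sum_lneE j0); apply: sum_lne_le => // i.
exact: dens_ge0.
Qed.

Lemma conf_set_fixpoint beta w p f : (0 <= beta)%R -> good_sample beta w ->
  (forall h : 'I_H, is_target M F (pol p) f (f h)) ->
  conf_set F D y beta w p f.
Proof.
move=> beta0 good fT h; rewrite leeBlDr//.
apply: bigmax_le; first exact: leNye.
move=> g _; apply: le_trans (loglik_le g good (fT h)) _.
rewrite leeD2l// lee_fin.
have : (0 <= N%:R * (1 - mean_affinity (nu h) (F (f h)) (F g)))%R.
  by rewrite mulr_ge0// subr_ge0 mean_affinity_le1.
by lra.
Qed.

(** The target is a competitor in the maximum, so the slack [7 * beta] adds to the [6 * beta] of
    [loglik_le]. *)
Lemma conf_set_hellinger beta w p f (h : 'I_H) (j : idx h) :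
  good_sample beta w -> conf_set F D y beta w p f ->
  is_target M F (pol p) f j ->
  \int[nu h]_xa hellinger (F (f h)) (F j) xa <= (13 * beta / N%:R)%:E.
Proof.
move=> good /(_ h) fC jT; have [j0 _] := good h f p j j jT.
have := loglik_le (f h) good jT.
have : loglik F D y w f p j - (7 * beta)%:E <= loglik F D y w f p (f h).
  apply: le_trans fC; rewrite leeB//.
  exact: (le_bigmax _ (fun g => loglik F D y w f p g)).
(* The target has positive density at every observation, so its log-likelihood is finite and
   cancels. *)
rewrite [loglik _ _ _ _ _ _ j]loglikE (sum_lneE j0) => jf fj.
have := le_trans jf fj; rewrite -EFinB -EFinD lee_fin => le7.
rewrite mean_hellinger_affinity lee_fin ler_pdivlMr ?ltr0n//.
move: le7; set b := mean_affinity _ _ _; set s := (\sum_i _)%R.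
by move=> le7; lra.
Qed.

Hypothesis D_meas : forall h i, measurable_fun setT (D h i).
Hypothesis y_meas : forall h f p i, measurable_fun setT (y h f p i).
Hypothesis sampling : pdisco_sampling M F pol D y Pr nu.

(** For fixed [(x, a)] the sampling mechanism for [c + y] is the Bellman operator applied to the law
    of [f] at [h.+1], and [j] is a density of the result. *)
Lemma zobs_law (h : 'I_H) f p (j : idx h) i B :
  is_target M F (pol p) f j -> measurable B ->
  Pr (S h f p i @^-1` (@zsample _ _ X A R @^-1` B)) =
  \int[nu h]_xa \int[lam]_(z in [set z | B (xa, z)]) (F j xa z)%:E.
Proof.
move=> jT mB; have [_ law] := sampling h f p.
have mzB : measurable (@zsample _ _ X A R @^-1` B).
  by rewrite -[X in measurable X]setTI; exact: measurable_zsample.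
apply: (etrans (law i _ mzB)); apply: eq_integral => xa _.
apply: (jT xa [set z | B (xa, z)]).
have := pair1_measurable xa measurableT mB; by rewrite setTI.
Qed.

Let n : R := (H%:R * #|Pi|%:R * #|tup|%:R)%R.

Lemma good_event (delta : R) (delta01 : (0 < delta < 1)%R) : (1 <= n)%R ->
  exists E : set Omega, [/\ measurable E, (1 - delta)%:E <= Pr E &
    forall w, E w -> good_sample (ln (n / delta)) w].
Proof.
move=> n1; have /andP[d0 d1] := delta01.
have n0 : (0 < n)%R by rewrite (lt_le_trans _ n1).
have nd0 : (0 < n / delta)%R by rewrite divr_gt0.
have K0 : (0 < (n / delta) ^+ 3)%R by rewrite exprn_gt0.
(* The competitor and the target have a type depending on [h]; encoding them as components at [h] of
   whole tuples makes the index set a plain product. The tuple [f] is indexed too, since it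
   determines the sampled [y]. *)
pose K : finType := ('I_H * tup * Pi * tup * tup)%type.
have /choice[Bad BadP] : forall k : K, exists B, measurable B /\
    (Pr B <= (((n / delta) ^+ 3)^-1)%:E /\
     let: (h, f, p, f', f'') := k in forall w, ~ B w ->
      is_target M F (pol p) f (f'' h) ->
      (forall i, (0 < F (f'' h) (zobs h f p i w).1 (zobs h f p i w).2)%R) /\
      (ratio_prod (S h f p) (F (f'' h)) (F (f' h)) w <
       (n / delta) ^+ 3 * expR (- (N%:R * (1 -
         mean_affinity (nu h) (F (f'' h)) (F (f' h))))))%R).
  move=> [[[[h f] p] f'] f''].
  have [jT|njT] := pselect (is_target M F (pol p) f (f'' h)); last first.
    (* If the component is not a target, there is nothing to exclude. *)
    exists set0; split => //; split; last by move=> w _ /njT.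
    by rewrite measure0 lee_fin invr_ge0 ltW.
  have mS i : measurable_fun setT (S h f p i).
    exact/measurable_fun_pair.
  have [indep _] := sampling h f p.
  have [B mB [PrB Bw]] := ratio_prod_tail mS indep
    (fun i B mB => zobs_law i jT mB) (F (f' h)) K0.
  by exists B; split => //; split => // w nB _; exact: Bw.
have mBad k : measurable (Bad k) by case: (BadP k).
exists (~` \bigcup_k Bad k); split.
- by apply: measurableC; apply: fin_bigcup_measurable.
- rewrite probability_setC; last by apply: fin_bigcup_measurable.
  rewrite EFinB leeB//; apply: le_trans (le_measure_bigcup_fin Pr mBad) _.
  apply: (@le_trans _ _ (\sum_(k : K) (((n / delta) ^+ 3)^-1)%:E)).
    by apply: lee_sum => k _; case: (BadP k) => _ [].
  rewrite sumEFin lee_fin sumr_const -mulr_natl.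
  have cardK : (#|{: K}|%:R <= n ^+ 3)%R.
    rewrite /n -!natrM -natrX ler_nat !card_prod card_ord.
    have : (0 < H * #|Pi|)%N.
      by move: n0; rewrite /n -!natrM ltr0n !muln_gt0 => /andP[].
    move: (#|Pi|) (#|{: tup}|) => P T HP.
    rewrite (_ : (H * P * T) ^ 3 = H * T * P * T * T * (H * P) ^ 2)%N.
      by rewrite leq_pmulr// expn_gt0 HP.
    by ring.
  apply: (le_trans (ler_wpM2r _ cardK)); first by rewrite invr_ge0 ltW.
  rewrite expr_div_n invf_div mulrC mulfVK ?gt_eqF ?exprn_gt0//.
  (* The total failure probability is at most [delta ^+ 3], hence at most [delta]. *)
  by rewrite exprS ler_piMr ?(ltW d0)// exprn_ile1 ?ltW.
move=> w nBad h f p g j jT.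
have [f' f'h] := tup_component f g; have [f'' f''h] := tup_component f j.
have [_ [_]] := BadP (h, f, p, f', f'').
rewrite f'h f''h => /(_ w) []//.
  by move=> Bw; apply: nBad; exists (h, f, p, f', f'').
move=> j0 ratio; split => //; move: ratio.
rewrite (_ : (n / delta) ^+ 3 = expR (3 * ln (n / delta)))%R.
  by rewrite -expRD.
by rewrite expRM_natl lnK// posrE.
Qed.

Hypothesis F_complete : bellman_complete M F.
Hypothesis cost_supp : forall (h : nat) (xa : X * A), (h < H)%N ->
  cost M h xa (~` `[0%R, 1%R]) = 0.

Lemma value_ge0 pi : 0 <= value M H pi.
Proof.
rewrite (value_sum pi cost_supp); apply: sume_ge0 => t _.
exact: step_cost_ge0.
Qed.

Lemma value_fin pi : value M H pi \is a fin_num.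
Proof.
rewrite (value_sum pi cost_supp); apply/sum_fin_numP => t _ _.
exact: (step_cost_fin cost_supp pi (ltn_ord t)).
Qed.

(** For every weight [t], [kmean_le_hellinger] is integrated over the occupancy of [pol p]; the
    Hellinger term is then moved to [nu h] at the price of the factor [C]. This is the hypothesis of
    [sqrt_recursion], and [0 < beta] makes its [e] positive. *)
Lemma init_mean_conf_set beta w p f (C : R) : (0 < beta)%R ->
  good_sample beta w -> conf_set F D y beta w p f ->
  (forall h : 'I_H, RN_supnorm (occupancy M (pol p) h) (nu h) <= C%:E) ->
  init_mean M hH F pol p f <=
  ((Num.sqrt (fine (value M H (pol p))) +
    H%:R * Num.sqrt (C * (13 * beta / N%:R))) ^+ 2)%:E.
Proof.
move=> beta0 good fC dC; set e := Num.sqrt (C * _).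
have C1 : (1 <= C)%R by apply: RN_supnorm_ge1 (dC (Ordinal hH)).
have e20 : (0 < C * (13 * beta / N%:R))%R.
  by rewrite mulr_gt0 ?(lt_le_trans _ C1)// divr_gt0 ?ltr0n// mulr_gt0.
have e0 : (0 < e)%R by rewrite sqrtr_gt0.
have e2 : (e ^+ 2 = C * (13 * beta / N%:R))%R by rewrite sqr_sqrtr// ltW.
pose u h := fine (step_mean M F (pol p) f h).
pose k h := fine (step_cost M (pol p) h).
have -> : init_mean M hH F pol p f = (u 0)%:E.
  by rewrite init_meanE /u fineK// step_mean_fin.
rewrite lee_fin.
have -> : fine (value M H (pol p)) = (\sum_(h < H) k h)%R.
  rewrite (value_sum _ cost_supp) -/(step_cost _ _ _).
  rewrite (eq_bigr (fun t : 'I_H => (k t)%:E)) ?sumEFin// => t _.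
  by rewrite fineK// (step_cost_fin cost_supp _ (ltn_ord t)).
apply: (@sqrt_recursion R H u k e e0).
- by move=> h; rewrite fine_ge0// step_cost_ge0.
- by move=> h; rewrite fine_ge0// step_mean_ge0.
- by rewrite /u step_mean_end.
move=> h t hlt t0; have [j jT] := exists_target F_complete (pol p) f (Ordinal hlt).
have t1 : (0 <= 1 + t)%R by rewrite addr_ge0// ltW.
have t2 : (0 <= 1 + t^-1)%R by rewrite addr_ge0// invr_ge0 ltW.
have cE : step_cost M (pol p) h = (k h)%:E.
  by rewrite fineK// (step_cost_fin cost_supp _ hlt).
have uE m : step_mean M F (pol p) f m = (u m)%:E by rewrite fineK// step_mean_fin.
have -> : (u h <= (1 + t) * (k h + u h.+1) + (1 + t^-1) * e ^+ 2)%R =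
    (step_mean M F (pol p) f h <=
     (1 + t)%:E * (step_cost M (pol p) h + step_mean M F (pol p) f h.+1) +
     (1 + t^-1)%:E * (e ^+ 2)%:E).
  by rewrite cE !uE -EFinD lee_fin.
have := target_mean cost_supp jT; rewrite /= => <-.
set occ := occupancy M (pol p) h; set g := F (f (Ordinal hlt)).
have mk g' : measurable_fun setT (kmean (@densk _ _ X A R lam g')).
  exact: measurable_kmean.
have k0 g' := kmean_ge0 (@densk _ _ X A R lam g').
have mh := measurable_hellinger g (F j); have h0 := hellinger_ge0 g (F j).
apply: (@le_trans _ _ ((1 + t)%:E * (\int[occ]_xa kmean (densk (F j)) xa) +
    (1 + t^-1)%:E * (\int[occ]_xa hellinger g (F j) xa))).
  rewrite -!ge0_integralZl_EFin// -ge0_integralD//; last 4 first.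
  - by move=> xa _; rewrite mule_ge0.
  - exact: measurable_funeM.
  - by move=> xa _; rewrite mule_ge0.
  - exact: measurable_funeM.
  rewrite /step_mean -[X in tupk F f X]/(nat_of_ord (Ordinal hlt)) tupk_ord.
  apply: ge0_le_integral => //.
  - by apply: emeasurable_funD; exact: measurable_funeM.
  - by move=> xa _; exact: kmean_le_hellinger.
rewrite leeD2l// lee_wpmul2l ?lee_fin//.
(* Change of measure from the occupancy to the data distribution. *)
apply: (le_trans (RN_supnorm_le_integral (dC (Ordinal hlt)) h0 mh)).
rewrite e2 EFinM lee_wpmul2l ?lee_fin ?(le_trans _ C1)//.
exact: conf_set_hellinger good fC jT.
Qed.

End pdisco_analysis.

(** * Regret bound *)

Section regret.
Context (R : realType).

Lemma sqrt_regret (v v' C H b : R) : (0 <= v)%R -> (1 <= C)%R -> (0 <= H)%R ->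
  (0 <= b)%R ->
  (v' <= (Num.sqrt v + H * Num.sqrt (C * (13 * b))) ^+ 2)%R ->
  (v' - v <= 9 * H * Num.sqrt (C * v * b) + 30 * H ^+ 2 * b * C)%R.
Proof.
move=> v0 C1 H0 b0 v'le.
have C0 : (0 <= C)%R by rewrite (le_trans _ C1).
have Cb0 : (0 <= C * b)%R by rewrite mulr_ge0.
have vCb : (0 <= C * v * b)%R by rewrite !mulr_ge0.
have Cb13 : (0 <= C * (13 * b))%R by rewrite !mulr_ge0.
set e := Num.sqrt (C * (13 * b)) in v'le.
have e0 : (0 <= e)%R by rewrite sqrtr_ge0.
have e2 : (e ^+ 2 = C * (13 * b))%R by rewrite sqr_sqrtr.
have s2 : (Num.sqrt v ^+ 2 = v)%R by rewrite sqr_sqrtr.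
(* Since [sqrt 13 <= 4], the cross term of the square gets the coefficient 8, below 9. *)
have ev : (e * Num.sqrt v <= 4 * Num.sqrt (C * v * b))%R.
  rewrite -ler_sqr ?nnegrE ?mulr_ge0 ?sqrtr_ge0//.
  rewrite !exprMn e2 s2 sqr_sqrtr//; nra.
apply: (le_trans (lerD v'le (lexx _))).
rewrite sqrrD exprMn e2 s2.
have X0 : (0 <= Num.sqrt (C * v * b))%R by rewrite sqrtr_ge0.
have HX0 : (0 <= H * Num.sqrt (C * v * b))%R by rewrite mulr_ge0.
have Hev : (H * (e * Num.sqrt v) <= H * (4 * Num.sqrt (C * v * b)))%R.
  by rewrite ler_wpM2l.
have HCb : (0 <= H ^+ 2 * (C * b))%R by rewrite mulr_ge0// sqr_ge0.
have -> : (v + Num.sqrt v * (H * e) *+ 2 + H ^+ 2 * (C * (13 * b)) - v =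
   2 * (H * (e * Num.sqrt v)) + 13 * (H ^+ 2 * (C * b)))%R by ring.
have -> : (9 * H * Num.sqrt (C * v * b) + 30 * H ^+ 2 * b * C =
   9 * (H * Num.sqrt (C * v * b)) + 30 * (H ^+ 2 * (C * b)))%R by ring.
have : (H * (4 * Num.sqrt (C * v * b)) = 4 * (H * Num.sqrt (C * v * b)))%R by ring.
move: (H * (e * _))%R (H * (4 * _))%R (H * Num.sqrt _)%R (H ^+ 2 * _)%R Hev HX0 HCb.
by move=> ? ? ? ? *; lra.
Qed.

End regret.

Lemma exists_argmax (R : realType) (I : finType) (P : I -> Prop)
    (m : I -> \bar R) (i0 : I) : P i0 ->
  exists i, P i /\ forall j, P j -> m j <= m i.
Proof.
move=> Pi0; have P0 : [pred i | `[< P i >]] i0 by apply/asboolP.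
case: (Order.TotalTheory.arg_maxP m P0) => i /asboolP Pi iP.
by exists i; split => // j Pj; apply: iP; apply/asboolP.
Qed.

Unset Implicit Arguments.

Theorem theorem6p1 (dX dA dO : measure_display)
    (X : measurableType dX) (A : measurableType dA) (Omega : measurableType dO)
    (R : realType) (Pr : probability Omega R)
    (lam : {sigma_finite_measure set R -> \bar R})
    (M : mdp X A R) (H N : nat) (hH : (0 < H)%N) (hN : (0 < N)%N)
    (A_finite : finite_set [set: A])
    (A_discrete : forall B : set A, measurable B)
    (cost_supp : forall (h : nat) (xa : X * A), (h < H)%N ->
       cost M h xa (~` `[0%R, 1%R]) = 0)
    (cost_dom : forall (h : nat) (xa : X * A), (h < H)%N ->
       cost M h xa `<< lam)
    (cumul_cost : forall pi : policy X A R,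
       state_law M pi H [set xs | ~~ (0 <= xs.2 <= 1)%R] = 0)
    (idx : 'I_H -> finType) (F : forall h : 'I_H, idx h -> cdens X A lam)
    (F_complete : bellman_complete M F)
    (Pi : finType) (pol : Pi -> policy X A R) (Pi_neq0 : (0 < #|Pi|)%N)
    (nu : 'I_H -> probability (X * A)%type R)
    (D : 'I_H -> 'I_N -> Omega -> X * A * R * X)
    (y : 'I_H -> {dffun forall h : 'I_H, idx h} -> Pi -> 'I_N -> Omega -> R)
    (D_meas : forall h i, measurable_fun setT (D h i))
    (y_meas : forall h f p i, measurable_fun setT (y h f p i))
    (sampling : pdisco_sampling M F pol D y Pr nu)
    (delta : R) (delta01 : (0 < delta < 1)%R) :
  let beta : R := ln (H%:R * #|Pi|%:R * #|{dffun forall h : 'I_H, idx h}|%:R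
                      / delta)%R in
  exists E : set Omega, [/\ measurable E, (1 - delta)%:E <= Pr E &
    forall w, E w ->
      (exists phat, pdisco_output M hH F pol D y beta w phat) /\
      forall phat, pdisco_output M hH F pol D y beta w phat ->
      forall p : Pi,
        value M H (pol phat) - value M H (pol p) <=
          (9 * H%:R)%:E * (concentrability M nu (pol p) * value M H (pol p)
                           * (beta / N%:R)%:E) `^ 2^-1
          + (30 * H%:R ^+ 2 * beta / N%:R)%:E * concentrability M nu (pol p)].
Proof.
move=> beta; pose n : R :=
  (H%:R * #|Pi|%:R * #|{dffun forall h : 'I_H, idx h}|%:R)%R.
have betaE : beta = ln (n / delta) by [].
have /card_gt0P[p0 _] := Pi_neq0.
have fix_ := exists_fixpoint F_complete.
(* The class of tuples is nonempty because it contains a Bellman fixpoint. *)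
have n1 : (1 <= n)%R.
  rewrite /n -!natrM ler1n !muln_gt0 hH Pi_neq0/=.
  by have [f _] := fix_ (pol p0); apply/card_gt0P; exists f.
have /andP[d0 d1] := delta01.
have beta0 : (0 < beta)%R.
  by rewrite betaE ln_gt0// ltr_pdivlMr// mul1r (lt_le_trans d1).
have [E [mE PrE good]] := good_event D_meas y_meas sampling delta01 n1.
exists E; split => // w /good; rewrite -betaE => {}good; split.
  (* The algorithm has an output: each confidence set contains a fixpoint, and the classes are
     finite. *)
  have /choice[fhat fhatP] : forall p, exists f, conf_set F D y beta w p f /\
      forall f', conf_set F D y beta w p f' ->
        init_mean M hH F pol p f' <= init_mean M hH F pol p f.
    move=> p; have [f fT] := fix_ (pol p).
    exact: exists_argmax (conf_set_fixpoint (ltW beta0) good fT).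
  have [p [_ pP]] := exists_argmax (P := fun=> True)
    (fun p => - init_mean M hH F pol p (fhat p)) (i0 := p0) I.
  by exists p, fhat; split => // p'; rewrite -leeN2; exact: pP.
move=> phat [fhat [fhatP phatP]] p.
have [fs fsT] := fix_ (pol phat).
(* Pessimism: the true value of the output is at most its own maximal prediction, which is at most
   that of the comparator by the choice of [phat]. *)
have Vle : value M H (pol phat) <= init_mean M hH F pol p (fhat p).
  rewrite -(step_mean_fixpoint cost_supp fsT) -(init_meanE M F hH pol).
  apply: le_trans (phatP p).
  apply: (fhatP phat).2; exact: conf_set_fixpoint (ltW beta0) good fsT.
have RNle (h : 'I_H) : RN_supnorm (occupancy M (pol p) h) (nu h) <=
    concentrability M nu (pol p).
  exact: (le_bigmax _ (fun h : 'I_H => RN_supnorm (occupancy M (pol p) h) (nu h))).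
have C0 : 0 <= concentrability M nu (pol p).
  apply: le_trans (RNle (Ordinal hH)); rewrite /RN_supnorm; case: asboolP => // _.
  exact: Lnorm_ge0.
have N0 : (0 < N%:R :> R)%R by rewrite ltr0n.
have H0 : (0 < H%:R :> R)%R by rewrite ltr0n.
(* For infinite concentrability the right-hand side is [+oo], its last term having a positive
   coefficient. *)
move: C0 RNle; case: (concentrability M nu (pol p)) => [C C0 RNle|_ _|//].
  have C1 : (1 <= C)%R by apply: RN_supnorm_ge1 (RNle (Ordinal hH)).
  have := le_trans Vle (init_mean_conf_set hH hN F_complete cost_supp beta0 good
    (fhatP p).1 RNle).
  have V0 := value_ge0 cost_supp (pol p).
  move: V0; rewrite -(fineK (value_fin cost_supp (pol phat))).
  rewrite -(fineK (value_fin cost_supp (pol p))) /=.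
  rewrite !lee_fin => V0 Vle'.
  rewrite powR12_sqrt; last first.
    by rewrite !mulr_ge0// ?(le_trans _ C1)// ?invr_ge0 ltW.
  rewrite -[(30 * _ * beta / _)%R]mulrA; apply: sqrt_regret => //.
  - by rewrite divr_ge0// ltW.
  - by rewrite (mulrA 13%R beta).
rewrite gt0_muley; last first.
  by rewrite lte_fin divr_gt0// !mulr_gt0// exprn_gt0.
rewrite addey ?leey// gt_eqF// (lt_le_trans (ltNyr 0%R))// mule_ge0//.
exact: poweR_ge0.
Qed.
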